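(* Let $(M,g)$ be a Riemannian manifold and let $T^1_1(M)$ be its $(1,1)$-tensor bundle with the rescaled Sasaki type metric ${}^Sg_f$, its Levi-Civita connection $\widetilde\nabla$, and the almost product structure $J$ given by $J({}^HX)=-{}^HX$, $J({}^VA)={}^VA$. The almost product connection ${}^{(P)}\widetilde\nabla_{\widetilde X}\widetilde Y=\widetilde\nabla_{\widetilde X}\widetilde Y-\widetilde S(\widetilde X,\widetilde Y)$, where $$\widetilde S(\widetilde X,\widetilde Y)=\tfrac12\{(\widetilde\nabla_{J\widetilde Y}J)\widetilde X+J((\widetilde\nabla_{\widetilde Y}J)\widetilde X)-J((\widetilde\nabla_{\widetilde X}J)\widetilde Y)\},$$ is symmetric (torsion-free) if and only if $M$ is flat.
   Context: All objects are smooth; Einstein summation. $f>0$ is a smooth function on $M$. $\Gamma_{ij}^h$ are the Christoffel symbols of $g$. $T^1_1(M)$ is the bundle of $(1,1)$-tensors, with induced local coordinates $(x^j,t_j^i)$, a point being $t=t_j^i\,\partial_i\otimes dx^j$ at $x$. The vertical lift of a $(1,1)$-tensor field $A$ is ${}^VA=A_j^i\,\partial/\partial t_j^i$; the horizontal lift of a vector field $X$ is ${}^HX=X^j\partial/\partial x^j+X^s(\Gamma_{sj}^mt_m^i-\Gamma_{sm}^it_j^m)\,\partial/\partial t_j^i$. The metric is ${}^Sg_f({}^VA,{}^VB)=g_{ic}g^{jl}A_j^iB_l^c$, ${}^Sg_f({}^VA,{}^HY)=0$, ${}^Sg_f({}^HX,{}^HY)=f\,g(X,Y)$. ''Flat''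 means that the curvature tensor of $g$ vanishes. *)

(* Defs.v *)
From HB Require Import structures.
From mathcomp Require Import all_boot all_order all_algebra.
From mathcomp Require Import all_classical all_reals.
From mathcomp Require Import topology normedtype derive.
From mathcomp Require Import ring lra.

Set Implicit Arguments.
Unset Strict Implicit.
Unset Printing Implicit Defensive.
Import Order.TTheory GRing.Theory Num.Theory.
Import numFieldNormedType.Exports.
Local Open Scope classical_set_scope.
Local Open Scope ring_scope.

Section Smooth.
Variables (R : realType) (N : nat) (V : normedModType R).

Fixpoint Ck (k : nat) (D : set 'rV[R]_N) (F : 'rV[R]_N -> V) : Prop :=
  match k with
  | 0%N => forall u, D u -> {for u, continuous F}
  | k'.+1 => (forall u, D u -> differentiable F u) /\
             (forall v, Ck k' D ('D_v F))
  end.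

(* Meant for open [D]: the values of [F] off [D] are then irrelevant. *)
Definition smooth_on (D : set 'rV[R]_N) (F : 'rV[R]_N -> V) : Prop :=
  forall k, Ck k D F.

End Smooth.

(* The chart [coord a] is meaningful on [dom a] only, and its inverse [point a]
   on the image [cdom a] only. *)
Record atlas (R : realType) (N : nat) (T : Type) := Atlas {
  index : Type ;
  dom : index -> set T ;
  coord : index -> T -> 'rV[R]_N ;
  point : index -> 'rV[R]_N -> T }.

Arguments Atlas {R N T}.

Section Manifold.
Variables (R : realType) (N : nat).

Section Charts.
Variables (T : Type) (A : atlas R N T).

Definition cdom (a : index A) : set 'rV[R]_N := coord a @` dom a.

Definition chart_part (W : set T) (a : index A) : set 'rV[R]_N :=
  cdom a `&` point a @^-1` W.

Definition transition (a b : index A) (u : 'rV[R]_N) : 'rV[R]_N :=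
  coord b (point a u).

Definition overlap (a b : index A) : set 'rV[R]_N := chart_part (dom b) a.

(* Open sets of the topology generated by the charts. *)
Definition atlas_open (W : set T) : Prop := forall a, open (chart_part W a).

End Charts.

(* The images of the charts have dimension [N]; [A] is any smooth atlas of the
   manifold, not necessarily the maximal one. *)
Record smooth_manifold (M : topologicalType) (A : atlas R N M) : Prop := {
  manifold_hausdorff : hausdorff_space M ;
  manifold_countable : @second_countable M ;
  manifold_cover : forall p, exists a : index A, dom a p ;
  manifold_dom_open : forall a : index A, open (dom a) ;
  manifold_cdom_open : forall a : index A, open (cdom a) ;
  manifold_coordK : forall (a : index A) p, dom a p -> point a (coord a p) = p ;
  manifold_coord_continuous :
    forall a : index A, {within dom a, continuous (coord a)} ;
  manifold_point_continuous :
    forall a : index A, {within cdom a, continuous (point a)} ;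
  manifold_transition_smooth :
    forall a b : index A, smooth_on (overlap a b) (transition a b) }.

Definition smooth_function (T : Type) (A : atlas R N T) (f : T -> R) : Prop :=
  forall a : index A, smooth_on (cdom a) (fun u => f (point a u) : R^o).

(* Tensor fields are given by their components in each chart. Tangent vectors
   are row vectors and [('J F u) i j] is the derivative of the j-th component of
   [F] in the i-th direction, so a vector [v] is pushed forward to
   [v *m 'J F u]. *)
Definition vector_field (T : Type) (A : atlas R N T) :=
  index A -> 'rV[R]_N -> 'rV[R]_N.

Definition metric_field (T : Type) (A : atlas R N T) :=
  index A -> 'rV[R]_N -> 'M[R]_N.

Definition vector_field_on (T : Type) (A : atlas R N T) (W : set T)
    (X : vector_field A) : Prop :=
  (forall a, smooth_on (chart_part W a) (X a)) /\
  (forall a b u, chart_part W a u -> dom b (point a u) ->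
     X b (transition a b u) = X a u *m 'J (transition a b) u).

Definition metric_form (G : 'M[R]_N) (v w : 'rV[R]_N) : R :=
  (v *m G *m w^T) 0 0.

Record riemannian_metric (T : Type) (A : atlas R N T) (g : metric_field A) :
    Prop := {
  metric_smooth : forall a, smooth_on (cdom a) (g a) ;
  metric_sym : forall a u, cdom a u -> (g a u)^T = g a u ;
  metric_pos : forall a u v, cdom a u -> v != 0 -> 0 < metric_form (g a u) v v ;
  metric_change : forall a b u, overlap a b u ->
    g a u = 'J (transition a b) u *m g b (transition a b u)
            *m ('J (transition a b) u)^T }.

Definition partial (i : 'I_N) (F : 'rV[R]_N -> R) (u : 'rV[R]_N) : R :=
  'D_(delta_mx 0 i) (F : 'rV[R]_N -> R^o) u.

(* [christoffel G u k i j] is Gamma^k_ij at [u]. *)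
Definition christoffel (G : 'rV[R]_N -> 'M[R]_N) (u : 'rV[R]_N)
    (k i j : 'I_N) : R :=
  2^-1 * \sum_(l < N) invmx (G u) k l *
    (partial i (fun v => G v j l) u + partial j (fun v => G v i l) u
     - partial l (fun v => G v i j) u).

(* [riemann G u l k i j] is R^l_kij, the l-th component of
   R(d_i, d_j) d_k. *)
Definition riemann (G : 'rV[R]_N -> 'M[R]_N) (u : 'rV[R]_N)
    (l k i j : 'I_N) : R :=
  partial i (fun v => christoffel G v l j k) u
  - partial j (fun v => christoffel G v l i k) u
  + \sum_(m < N) (christoffel G u l i m * christoffel G u m j k
                  - christoffel G u l j m * christoffel G u m i k).

Definition flat (T : Type) (A : atlas R N T) (g : metric_field A) : Prop :=
  forall (a : index A) u l k i j, cdom a u -> riemann (g a) u l k i j = 0.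

Definition levi_civita (T : Type) (A : atlas R N T) (g : metric_field A)
    (X Y : vector_field A) : vector_field A :=
  fun a u => 'D_(X a u) (Y a) u +
    \row_(k < N) \sum_(i < N) \sum_(j < N)
      christoffel (g a) u k i j * X a u 0 i * Y a u 0 j.

Definition bracket (T : Type) (A : atlas R N T) (X Y : vector_field A) :
    vector_field A :=
  fun a u => 'D_(X a u) (Y a) u - 'D_(Y a u) (X a) u.

(* Connections are local operators, so they are tested on the vector fields of
   every open subset, including the whole manifold. *)
Definition torsion_free (T : Type) (A : atlas R N T)
    (nabla : vector_field A -> vector_field A -> vector_field A) : Prop :=
  forall (W : set T) (X Y : vector_field A), atlas_open A W ->
    vector_field_on W X -> vector_field_on W Y ->
    forall a u, chart_part W a u ->
      nabla X Y a u - nabla Y X a u = bracket X Y a u.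

Lemma partial_sym (G : 'rV[R]_N -> 'M[R]_N) u l i j :
  (\forall v \near u, (G v)^T = G v) ->
  partial l (fun v => G v i j) u = partial l (fun v => G v j i) u.
Proof.
move=> symG; apply: near_eq_derive; near=> v.
have /matrixP /(_ j i) : (G v)^T = G v by near: v.
by rewrite mxE.
Unshelve. all: by end_near. Qed.

Lemma christoffel_sym (G : 'rV[R]_N -> 'M[R]_N) u k i j :
  (\forall v \near u, (G v)^T = G v) ->
  christoffel G u k i j = christoffel G u k j i.
Proof.
move=> symG; rewrite /christoffel; congr (_ * _); apply: eq_bigr => l _.
by rewrite [X in X - _]addrC (partial_sym l i j symG).
Qed.

(* With the symmetry above, this says that [levi_civita g] is the torsion-free
   metric connection of [g]. *)
Lemma christoffel_metric (G : 'rV[R]_N -> 'M[R]_N) u k i j :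
  G u \in unitmx -> (\forall v \near u, (G v)^T = G v) ->
  partial k (fun v => G v i j) u =
  \sum_(m < N) (christoffel G u m k i * G u m j +
                christoffel G u m k j * G u i m).
Proof.
move=> unitG symG.
have symu : (G u)^T = G u by exact: nbhs_singleton symG.
have symE p q : G u p q = G u q p by rewrite -{1}symu mxE.
have lower p q r : \sum_(m < N) christoffel G u m p q * G u r m =
    2^-1 * (partial p (fun v => G v q r) u + partial q (fun v => G v p r) u
            - partial r (fun v => G v p q) u).
  pose c l := partial p (fun v => G v q l) u + partial q (fun v => G v p l) u
              - partial l (fun v => G v p q) u.
  transitivity (2^-1 * \sum_(l < N) (G u *m invmx (G u)) r l * c l).
    rewrite mulr_sumr; under eq_bigr => m _ do
      rewrite /christoffel -mulrA mulr_suml mulr_sumr.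
    rewrite exchange_big /=; apply: eq_bigr => l _.
    rewrite mxE mulr_suml mulr_sumr; apply: eq_bigr => m _.
    by rewrite -/(c l) mulrAC [invmx _ _ _ * _]mulrC.
  rewrite mulmxV // (bigD1 r) //= big1 ?addr0 ?mxE ?eqxx ?mul1r //.
  by move=> l lr; rewrite mxE eq_sym (negbTE lr) mul0r.
rewrite big_split /=; under eq_bigr => m _ do rewrite (symE m j).
rewrite !lower -mulrDr (partial_sym k j i symG).
by field.
Qed.

End Manifold.

Lemma linear_row_sum (R : realType) N (h : 'rV[R]_N -> R^o) (v : 'rV[R]_N) :
  linear h -> h v = \sum_(i < N) v 0 i * h (delta_mx 0 i).
Proof.
move=> hlin; have h0 : h 0 = 0.
  by have := hlin (-1) 0 0; rewrite scaler0 addr0 scaleN1r addNr.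
have hD x y : h (x + y) = h x + h y.
  by have := hlin 1 x y; rewrite !scale1r.
rewrite {1}(row_sum_delta v) (big_morph h hD h0); apply: eq_bigr => i _.
by have := hlin (v 0 i) (delta_mx 0 i) 0; rewrite h0 !addr0.
Qed.

Section TensorBundle.
Variables (R : realType) (n : nat) (M : Type) (A : atlas R n M).

(* The entry [t i j] is t^i_j: the upper index is the row. *)
Definition tensor_change (a b : index A) (u : 'rV[R]_n) (t : 'M[R]_n) :
    'M[R]_n :=
  ('J (transition a b) u)^T *m t *m invmx ('J (transition a b) u)^T.

(* A (1,1)-tensor at [p] is the family of its components in the charts around
   [p], extended by zero to the other charts. *)
Definition tensor11_at (p : M) (t : index A -> 'M[R]_n) : Prop :=
  (forall a, ~ dom a p -> t a = 0) /\
  (forall a b, dom a p -> dom b p -> t b = tensor_change a b (coord a p) (t a)).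

Definition bcoord (u : 'rV[R]_(n + n * n)) : 'rV[R]_n := lsubmx u.

Definition fcoord (u : 'rV[R]_(n + n * n)) : 'M[R]_n := vec_mx (rsubmx u).

Definition bundle11 : atlas R (n + n * n) (M * (index A -> 'M[R]_n)) := Atlas
  (index A)
  (fun a => [set q | dom a q.1 /\ tensor11_at q.1 q.2])
  (fun a q => row_mx (coord a q.1) (mxvec (q.2 a)))
  (fun a u => (point a (bcoord u),
     fun b => if `[< dom b (point a (bcoord u)) >]
              then tensor_change a b (bcoord u) (fcoord u) else 0)).

Section Lifts.
Variable G : 'rV[R]_n -> 'M[R]_n.
Implicit Types (u xi eta : 'rV[R]_(n + n * n)) (X Y : 'rV[R]_n) (B C : 'M[R]_n).

Definition vlift B : 'rV[R]_(n + n * n) := row_mx 0 (mxvec B).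

Definition hlift u X : 'rV[R]_(n + n * n) :=
  row_mx X (mxvec (\matrix_(i, j) \sum_(s < n) X 0 s * \sum_(m < n)
    (christoffel G (bcoord u) m s j * fcoord u i m
     - christoffel G (bcoord u) i s m * fcoord u m j))).

Definition hpart xi : 'rV[R]_n := lsubmx xi.

Definition vpart u xi : 'M[R]_n := vec_mx (rsubmx (xi - hlift u (hpart xi))).

(* The extension of g to (1,1)-tensors. *)
Definition tensor_form u B C : R :=
  \sum_(i < n) \sum_(j < n) \sum_(c < n) \sum_(l < n)
    G (bcoord u) i c * invmx (G (bcoord u)) j l * B i j * C c l.

Definition sasaki_form (f : 'rV[R]_n -> R) u xi eta : R :=
  tensor_form u (vpart u xi) (vpart u eta) +
  f (bcoord u) * metric_form (G (bcoord u)) (hpart xi) (hpart eta).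

Definition sasaki_mx (f : 'rV[R]_n -> R) u : 'M[R]_(n + n * n) :=
  \matrix_(i, j) sasaki_form f u (delta_mx 0 i) (delta_mx 0 j).

(* J, characterized by [product_structure_hlift] and [product_structure_vlift]
   below. *)
Definition product_structure u xi : 'rV[R]_(n + n * n) :=
  vlift (vpart u xi) - hlift u (hpart xi).

Lemma hlift_is_linear u : linear (hlift u).
Proof.
move=> a X Y; rewrite /hlift scale_row_mx add_row_mx -linearP /=; congr row_mx.
congr mxvec; apply/matrixP => i j; rewrite !mxE mulr_sumr -big_split /=.
by apply: eq_bigr => s _; rewrite !mxE mulrDl mulrA.
Qed.

HB.instance Definition _ u :=
  GRing.isLinear.Build R 'rV[R]_n 'rV[R]_(n + n * n) _ (hlift u)
    (hlift_is_linear u).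

Lemma vpart_is_linear u : linear (vpart u).
Proof.
move=> a xi eta; rewrite /vpart /hpart !linearB /= !linearP /=.
by rewrite scalerN addrACA.
Qed.

HB.instance Definition _ u :=
  GRing.isLinear.Build R 'rV[R]_(n + n * n) 'M[R]_n _ (vpart u)
    (vpart_is_linear u).

Lemma hpart_vlift B : hpart (vlift B) = 0.
Proof. exact: row_mxKl. Qed.

Lemma hpart_hlift u X : hpart (hlift u X) = X.
Proof. exact: row_mxKl. Qed.

Lemma vpart_vlift u B : vpart u (vlift B) = B.
Proof. by rewrite /vpart hpart_vlift linear0 subr0 row_mxKr mxvecK. Qed.

Lemma vpart_hlift u X : vpart u (hlift u X) = 0.
Proof. by rewrite /vpart hpart_hlift subrr !linear0. Qed.

Lemma product_structure_hlift u X :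
  product_structure u (hlift u X) = - hlift u X.
Proof.
by rewrite /product_structure vpart_hlift hpart_hlift /vlift linear0 row_mx0
  sub0r.
Qed.

Lemma product_structure_vlift u B : product_structure u (vlift B) = vlift B.
Proof.
by rewrite /product_structure vpart_vlift hpart_vlift linear0 subr0.
Qed.

Section SasakiForm.
Variables (f : 'rV[R]_n -> R) (u : 'rV[R]_(n + n * n)).

Lemma sasaki_form_linearl eta :
  linear (fun xi => sasaki_form f u xi eta : R^o).
Proof.
move=> a xi xi'; rewrite /sasaki_form /metric_form /hpart !linearP /=.
rewrite !mulmxDl -!scalemxAl !mxE scalerDr addrACA.
congr (_ + _); last by rewrite mulrDr mulrCA.
rewrite /tensor_form scaler_sumr -big_split; apply: eq_bigr => i _ /=.
rewrite scaler_sumr -big_split; apply: eq_bigr => j _ /=.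
rewrite scaler_sumr -big_split; apply: eq_bigr => c _ /=.
rewrite scaler_sumr -big_split; apply: eq_bigr => l _ /=.
by rewrite !mxE; rewrite /GRing.scale /=; ring.
Qed.

Lemma sasaki_form_linearr xi :
  linear (fun eta => sasaki_form f u xi eta : R^o).
Proof.
move=> a eta eta'; rewrite /sasaki_form /metric_form /hpart !linearP /=.
rewrite !mxE scalerDr addrACA.
congr (_ + _); last by rewrite mulrDr mulrCA.
rewrite /tensor_form scaler_sumr -big_split; apply: eq_bigr => i _ /=.
rewrite scaler_sumr -big_split; apply: eq_bigr => j _ /=.
rewrite scaler_sumr -big_split; apply: eq_bigr => c _ /=.
rewrite scaler_sumr -big_split; apply: eq_bigr => l _ /=.
by rewrite !mxE; rewrite /GRing.scale /=; ring.
Qed.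

Lemma sasaki_mxE xi eta :
  metric_form (sasaki_mx f u) xi eta = sasaki_form f u xi eta.
Proof.
rewrite (linear_row_sum xi (sasaki_form_linearl eta)) /metric_form -mulmxA mxE.
apply: eq_bigr => i _; congr (_ * _).
rewrite (linear_row_sum eta (sasaki_form_linearr _)) mxE.
by apply: eq_bigr => j _; rewrite !mxE mulrC.
Qed.

Lemma sasaki_vv B C :
  metric_form (sasaki_mx f u) (vlift B) (vlift C) = tensor_form u B C.
Proof.
rewrite sasaki_mxE /sasaki_form !vpart_vlift !hpart_vlift.
by rewrite /metric_form !mul0mx mxE mulr0 addr0.
Qed.

Lemma sasaki_vh B Y :
  metric_form (sasaki_mx f u) (vlift B) (hlift u Y) = 0.
Proof.
rewrite sasaki_mxE /sasaki_form vpart_hlift hpart_vlift.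
rewrite /metric_form !mul0mx mxE mulr0 addr0 /tensor_form.
do 4 (apply: big1 => ? _); by rewrite [X in _ * X]mxE mulr0.
Qed.

Lemma sasaki_hh X Y :
  metric_form (sasaki_mx f u) (hlift u X) (hlift u Y) =
  f (bcoord u) * metric_form (G (bcoord u)) X Y.
Proof.
rewrite sasaki_mxE /sasaki_form !vpart_hlift !hpart_hlift /tensor_form.
rewrite big1 ?add0r // => i _.
do 3 (apply: big1 => ? _); by rewrite [X in _ * X]mxE mulr0.
Qed.

End SasakiForm.

End Lifts.

Variables (f : M -> R) (g : metric_field A).
Implicit Types X Y : vector_field bundle11.

(* The components of the rescaled Sasaki metric in the induced charts; its values
   on lifts are [sasaki_vv], [sasaki_vh] and [sasaki_hh] above. *)
Definition sasaki : metric_field bundle11 :=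
  fun a : index A => sasaki_mx (g a) (fun x => f (point a x)).

(* J applied to a vector field. *)
Definition pJ X : vector_field bundle11 :=
  fun a u => product_structure (g a) u (X a u).

Local Notation nabla := (levi_civita sasaki).

(* (nabla_X J) Y *)
Definition nablaJ X Y : vector_field bundle11 :=
  fun a u => nabla X (pJ Y) a u - pJ (nabla X Y) a u.

Definition product_tensor X Y : vector_field bundle11 :=
  fun a u => 2^-1 *:
    (nablaJ (pJ Y) X a u + pJ (nablaJ Y X) a u - pJ (nablaJ X Y) a u).

Definition product_connection X Y : vector_field bundle11 :=
  fun a u => nabla X Y a u - product_tensor X Y a u.

End TensorBundle.

(* Main.v *)
Require Import Defs.
From HB Require Import structures.
From mathcomp Require Import all_boot all_order all_algebra.
From mathcomp Require Import all_classical all_reals.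
From mathcomp Require Import topology normedtype landau derive.
From mathcomp Require Import ring lra.

(** The torsion of the almost product connection is
    [S(Y, X) - S(X, Y)], because the Levi-Civita connection [nabla] of the
    Sasaki metric has none.  Everything therefore reduces to the tensor
    [(xi, Y) |-> (nabla_xi J) Y], computed in the frame adapted to [J]: the
    horizontal lifts [H X] of constant vectors and the vertical lifts [V B] of
    constant matrices, in an induced chart with coordinates [(x, t)].

    Since [J] is [1 - 2P] with [P] the horizontal projection, the tensor
    [nabla J] only sees the vertical part of [nabla (H X)] and the horizontal
    part of [nabla (V B)] ([cov_product_structure]).  Four facts determine these
    parts.  The metric of the fibres is parallel, hence [nabla_(V B) (V C)] is
    vertical ([fibre_totally_geodesic]), and, [H X] being orthogonal to the
    vertical fields, [nabla_(V B) (H X)] is horizontal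
    ([vpart_cov_vlift_hlift]).  The vertical part of [nabla_(H X) (H Y)] is
    half of the vertical field [[H X, H Y]] ([vpart_cov_hlift_hlift]), which is
    [t R(X, Y) - R(X, Y) t] with [R] the curvature of [g] ([bracket_hlift]).  By
    orthogonality again, the horizontal part of [nabla_(H X) (V B)] is governed
    by the same bracket ([hpart_cov_hlift_vlift]).

    If [g] is flat, then all these parts vanish, [nabla J = 0] and [S = 0]
    ([flat_torsion_free]).  Conversely, on fields which take the values [H X]
    and [H Y] at a point, [S(X, Y)] is half of [[H X, H Y]] and is therefore
    antisymmetric; a vanishing torsion makes it zero, so that [R(X, Y)] commutes
    with every matrix [t] and is a scalar matrix.  It is also skew-adjoint for
    [g] ([curv_mx_skew]), hence zero ([torsion_free_flat]).  Skew-adjointness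
    rests on the symmetry of the second derivatives of [g] ([derive_commute]).

    The converse also needs vector fields on an open subset of the bundle with
    prescribed value at a point.  They are the coordinate fields of the induced
    charts, and checking that they are smooth in every other chart is what the
    calculus of C^k maps and the study of transition maps are for. *)

Set Implicit Arguments.
Unset Strict Implicit.
Unset Printing Implicit Defensive.
Import Order.TTheory GRing.Theory Num.Theory.
Import numFieldNormedType.Exports.
Local Open Scope classical_set_scope.
Local Open Scope ring_scope.
(* The sequence library also exports an [index], which would hide the index
   type of an atlas. *)
Import Defs.

(** * Maps of class C^k *)

(** Differentiability is a property of the germ: the first order expansion of [f]
    at [x] is also one of [g]. *)
Lemma near_eq_differentiable (R : realType) (V W : normedModType R)
    (f g : V -> W) (x : V) :
  (\forall y \near x, f y = g y) -> differentiable f x -> differentiable g x.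
Proof.
move=> fg df; have dfc := diff_continuous df.
have E : g \o shift x = cst (g x) + 'd f x +o_ 0 id.
  apply/eqaddoP => e e0.
  have [_ /eqaddoP/(_ e e0) Hf] := (diff_locallyP _ _).1 df.
  have {}fg : \forall y \near (0 : V), f (y + x) = g (y + x).
    have cs : (fun y => y + x) @ (0 : V) --> x.
      rewrite -[X in _ --> X]add0r; apply: cvgD; [exact: cvg_id|exact: cvg_cst].
    exact: cs _ fg.
  near=> y.
  have -> : (g \o shift x - (cst (g x) + 'd f x)) y =
            (f \o shift x - (cst (f x) + 'd f x)) y.
    rewrite !fctE /=; congr (_ - (_ + _)); first by apply/esym; near: y.
    by apply/esym; have := nbhs_singleton fg; rewrite add0r.
  by near: y.
apply/diff_locallyP; have -> : 'd g x = 'd f x :> (V -> W).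
  exact: diff_unique E.
by [].
Unshelve. all: by end_near. Qed.

Lemma cvg_finite_sum (R : realType) (V : normedModType R) (T : Type)
    (F : set_system T) (FF : Filter F) (I : Type) (r : seq I) (h : I -> T -> V)
    (l : I -> V) :
  (forall i, h i x @[x --> F] --> l i) ->
  \sum_(i <- r) h i x @[x --> F] --> \sum_(i <- r) l i.
Proof.
move=> hl; elim: r => [|i r IH].
  by under eq_cvg do rewrite big_nil; rewrite big_nil; exact: cvg_cst.
under eq_cvg do rewrite big_cons; rewrite big_cons; exact: cvgD.
Qed.

Section CkCalculus.
Variables (R : realType) (N : nat).
Implicit Types (D : set 'rV[R]_N) (k : nat).

(** Openness of [D] makes the equality hold near each point of [D], and hence
    between the derivatives on [D]; every rule below goes through this lemma,
    because the derivation rules only hold at points of differentiability. *)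
Lemma Ck_eq (V : normedModType R) k D (F G : 'rV[R]_N -> V) :
  open D -> (forall u, D u -> F u = G u) -> Ck k D F -> Ck k D G.
Proof.
move=> oD; elim: k F G => [|k IH] F G FG /=.
  move=> cF u Du.
  have nFG : \forall v \near u, F v = G v.
    by near=> v; apply: FG; near: v; exact: open_nbhs_nbhs.
  rewrite /prop_for /continuous_at -(FG _ Du).
  exact: cvg_trans (near_eq_cvg nFG) (cF _ Du).
case=> dF sF; split=> [u Du|v].
  apply: near_eq_differentiable (dF _ Du).
  by near=> w; apply: FG; near: w; exact: open_nbhs_nbhs.
apply: IH (sF v) => u Du; apply: near_eq_derive.
by near=> w; apply: FG; near: w; exact: open_nbhs_nbhs.
Unshelve. all: by end_near. Qed.

Lemma Ck_pred (V : normedModType R) k D (F : 'rV[R]_N -> V) :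
  Ck k.+1 D F -> Ck k D F.
Proof.
elim: k F => [|k IH] F [dF sF] /=.
  by move=> u Du; exact/differentiable_continuous/dF.
by split=> // v; exact/IH/sF.
Qed.

Lemma Ck_cst (V : normedModType R) k D (c : V) : Ck k D (fun=> c).
Proof.
elim: k c => [|k IH] c /=; first by move=> u _; exact: cst_continuous.
split=> [u _|v]; first exact: differentiable_cst.
by have -> : 'D_v (fun=> c) = (fun=> 0) by apply/funext => u; exact: derive_cst.
Qed.

Lemma CkD (V : normedModType R) k D (F G : 'rV[R]_N -> V) : open D ->
  Ck k D F -> Ck k D G -> Ck k D (fun u => F u + G u).
Proof.
move=> oD; elim: k F G => [|k IH] F G /=.
  by move=> cF cG u Du; apply: continuousD; [exact: cF|exact: cG].
move=> [dF sF] [dG sG]; split=> [u Du|v].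
  by apply: differentiableD; [exact: dF|exact: dG].
apply: Ck_eq (IH _ _ (sF v) (sG v)) => // u Du; apply/esym.
by apply: deriveD; apply: diff_derivable; [exact: dF|exact: dG].
Qed.

Lemma Ck_sum (V : normedModType R) (I : Type) (r : seq I) (P : pred I) k D
    (F : I -> 'rV[R]_N -> V) : open D ->
  (forall i, P i -> Ck k D (F i)) -> Ck k D (fun u => \sum_(i <- r | P i) F i u).
Proof.
move=> oD sF; elim: r => [|i r IH].
  by apply: Ck_eq (Ck_cst k D (0 : V)) => // u _; rewrite big_nil.
case Pi : (P i); last first.
  by apply: Ck_eq IH => // u _; rewrite big_cons Pi.
by apply: Ck_eq (CkD oD (sF i Pi) IH) => // u _; rewrite big_cons Pi.
Qed.

Lemma CkM k D (F G : 'rV[R]_N -> R^o) : open D ->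
  Ck k D F -> Ck k D G -> Ck k D (fun u => F u * G u : R^o).
Proof.
move=> oD; elim: k F G => [|k IH] F G.
  by move=> cF cG u Du; apply: continuousM; [exact: cF|exact: cG].
move=> cF cG; have [dF sF] := cF; have [dG sG] := cG; split=> [u Du|v].
  by apply: differentiableM; [exact: dF|exact: dG].
apply: Ck_eq (CkD oD (IH _ _ (Ck_pred cF) (sG v)) (IH _ _ (Ck_pred cG) (sF v))) =>
  // u Du; apply/esym.
by apply: deriveM; apply: diff_derivable; [exact: dF|exact: dG].
Qed.

Lemma Ck_prod (I : Type) (r : seq I) (P : pred I) k D
    (F : I -> 'rV[R]_N -> R^o) : open D ->
  (forall i, P i -> Ck k D (F i)) ->
  Ck k D (fun u => \prod_(i <- r | P i) F i u : R^o).
Proof.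
move=> oD sF; elim: r => [|i r IH].
  by apply: Ck_eq (Ck_cst k D (1 : R^o)) => // u _; rewrite big_nil.
case Pi : (P i); last first.
  by apply: Ck_eq IH => // u _; rewrite big_cons Pi.
by apply: Ck_eq (CkM oD (sF i Pi) IH) => // u _; rewrite big_cons Pi.
Qed.

(** The derivative of the inverse is [- (1/F)^2 F'], so that the rule follows by
    induction from the product rule. *)
Lemma CkV k D (F : 'rV[R]_N -> R^o) : open D -> (forall u, D u -> F u != 0) ->
  Ck k D F -> Ck k D (fun u => (F u)^-1 : R^o).
Proof.
move=> oD F0; elim: k => [|k IH].
  by move=> cF u Du; apply: continuousV; [exact: F0|exact: cF].
move=> cF; have [dF sF] := cF; split=> [u Du|v].
  by apply: differentiableV; [exact: dF|exact: F0].
have cV := IH (Ck_pred cF).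
apply: Ck_eq (CkM oD (Ck_cst k D (-1 : R^o)) (CkM oD (CkM oD cV cV) (sF v))) =>
  // u Du; apply/esym; rewrite deriveV ?F0 //; last exact/diff_derivable/dF.
by rewrite expr2 invfM mulN1r scaleNr.
Qed.

(** Reduces matrix-valued maps to scalar ones, for which products and inverses
    are available. *)
Lemma Ck_mxP m n k D (F : 'rV[R]_N -> 'M[R]_(m, n)) : open D ->
  Ck k D F <-> forall i j, Ck k D (fun u => F u i j : R^o).
Proof.
move=> oD; elim: k F => [|k IH] F.
  split=> [cF i j u Du|cF u Du].
    apply: (@continuous_comp _ _ _ F (fun M : 'M[R]_(m, n) => M i j : R^o)).
      exact: cF.
    exact: coord_continuous.
  have -> : F = fun v => \sum_i \sum_j F v i j *: delta_mx i j.
    by apply/funext => v; exact: matrix_sum_delta.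
  rewrite /prop_for /continuous_at.
  apply: (cvg_finite_sum (nbhs_filter u)) => i.
  apply: (cvg_finite_sum (nbhs_filter u)) => j.
  by apply: cvgZr_tmp; exact: cF.
split=> [[dF sF] i j|cF].
  split=> [u Du|v].
    apply: (@differentiable_comp _ _ _ _ F (fun M : 'M[R]_(m, n) => M i j : R^o)).
      exact: dF.
    exact: differentiable_coord.
  apply: Ck_eq ((IH _).1 (sF v) i j) => // u Du.
  by rewrite derive_mx ?mxE //; exact/diff_derivable/dF.
have dF u : D u -> differentiable F u.
  move=> Du; have -> : F = \sum_i \sum_j (fun v => F v i j *: delta_mx i j).
    apply/funext => v; rewrite {1}(matrix_sum_delta (F v)) fct_sumE.
    by apply: eq_bigr => i _; rewrite fct_sumE.
  apply: differentiable_sum => i; apply: differentiable_sum => j.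
  by apply: differentiableZl; have [+ _] := cF i j; exact.
split=> // v; apply/IH => i j; have [_ sF] := cF i j.
apply: Ck_eq (sF v) => // u Du.
by rewrite derive_mx ?mxE //; exact/diff_derivable/dF.
Qed.

Lemma Ck_coord k D i : Ck k D (fun u => u 0 i : R^o).
Proof.
case: k => [|k]; first by move=> u _; exact: coord_continuous.
split=> [u _|v]; first exact: differentiable_coord.
suff -> : 'D_v (fun u : 'rV[R]_N => u 0 i : R^o) = fun=> v 0 i by exact: Ck_cst.
apply/funext => u.
have := derive_mx (@derivable_id R 'rV[R]_N u v).
by rewrite derive_id => /matrixP/(_ 0 i); rewrite mxE => <-.
Qed.

Lemma Ck_id k D : open D -> Ck k D id.
Proof. by move=> oD; apply/Ck_mxP => // i j; rewrite ord1; exact: Ck_coord. Qed.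

End CkCalculus.

(** By the chain rule in coordinates, a derivative of [F \o h] is a sum of
    products of derivatives of [h] with compositions of derivatives of [F] with
    [h]; the induction hypothesis applies to the latter. *)
Lemma Ck_comp (R : realType) (N N' : nat) k (D : set 'rV[R]_N)
    (D' : set 'rV[R]_N') (h : 'rV[R]_N -> 'rV[R]_N') (F : 'rV[R]_N' -> R^o) :
  open D -> open D' -> (forall u, D u -> D' (h u)) ->
  Ck k D h -> Ck k D' F -> Ck k D (F \o h).
Proof.
move=> oD oD' hD; elim: k F => [|k IH] F.
  by move=> ch cF u Du; apply: continuous_comp; [exact: ch|exact/cF/hD].
move=> ch cF; have [dh sh] := ch; have [dF sF] := cF; split=> [u Du|v].
  by apply: differentiable_comp; [exact: dh|exact/dF/hD].
have key : Ck k D (fun u => \sum_j ('D_v h u) 0 j * ('D_(delta_mx 0 j) F \o h) u : R^o).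
  apply: Ck_sum => // j _; apply: CkM => //.
    exact: ((Ck_mxP k _ oD).1 (sh v) 0 j).
  exact: IH (Ck_pred ch) (sF _).
apply: Ck_eq key => // u Du.
have dhu := dh _ Du; have dFu := dF _ (hD _ Du).
rewrite [RHS]deriveE; last exact: differentiable_comp.
rewrite diff_comp //= -(deriveE v dhu).
rewrite [in RHS](row_sum_delta ('D_v h u)) linear_sum.
by apply: eq_bigr => j _; rewrite linearZ /= -deriveE.
Qed.

(** * Matrix-valued maps of class C^k *)

Section MatrixCalculus.
Variables (R : realType) (N : nat) (k : nat) (D : set 'rV[R]_N).
Hypothesis oD : open D.

Lemma Ck_linear m n p q (L : 'M[R]_(m, n) -> 'M[R]_(p, q))
    (F : 'rV[R]_N -> 'M[R]_(m, n)) :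
  linear L -> Ck k D F -> Ck k D (fun u => L (F u)).
Proof.
move=> linL /Ck_mxP cF; apply/Ck_mxP => // a b.
pose Lm := GRing.isLinear.Build _ _ _ _ L linL.
pose L' : {linear 'M[R]_(m, n) -> 'M[R]_(p, q)} := HB.pack L Lm.
have key : Ck k D (fun u => \sum_i \sum_j F u i j * L' (delta_mx i j) a b : R^o).
  apply: Ck_sum => // i _; apply: Ck_sum => // j _.
  by apply: CkM => //; [exact: cF|exact: Ck_cst].
apply: Ck_eq key => // u _.
rewrite -[L (F u)]/(L' (F u)) [in RHS](matrix_sum_delta (F u)) linear_sum summxE.
apply: eq_bigr => i _; rewrite linear_sum summxE.
by apply: eq_bigr => j _; rewrite linearZ mxE.
Qed.

Lemma Ck_mulmx m n p (F : 'rV[R]_N -> 'M[R]_(m, n))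
    (G : 'rV[R]_N -> 'M[R]_(n, p)) :
  Ck k D F -> Ck k D G -> Ck k D (fun u => F u *m G u).
Proof.
move=> /Ck_mxP cF /Ck_mxP cG; apply/Ck_mxP => // a b.
have key : Ck k D (fun u => \sum_j F u a j * G u j b : R^o).
  by apply: Ck_sum => // j _; apply: CkM => //; [exact: cF|exact: cG].
by apply: Ck_eq key => // u _; rewrite mxE.
Qed.

Lemma Ck_det n (F : 'rV[R]_N -> 'M[R]_n) :
  (forall i j, Ck k D (fun u => F u i j : R^o)) ->
  Ck k D (fun u => \det (F u) : R^o).
Proof.
move=> cF; apply: Ck_sum => // s _; apply: CkM => //; first exact: Ck_cst.
by apply: Ck_prod => // i _; exact: cF.
Qed.

(** Cramer's formula: the entries of the inverse are minors divided by the
    determinant. *)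
Lemma Ck_invmx n (F : 'rV[R]_N -> 'M[R]_n) :
  (forall u, D u -> F u \in unitmx) -> Ck k D F ->
  Ck k D (fun u => invmx (F u)).
Proof.
move=> uF /Ck_mxP cF; apply/Ck_mxP => // a b.
have key : Ck k D (fun u => (\det (F u))^-1 *
    ((-1) ^+ (b + a) * \det (row' b (col' a (F u)))) : R^o).
  apply: CkM => //.
    apply: CkV => //; last by apply: Ck_det => i j; exact: cF.
    by move=> u /uF; rewrite unitmxE unitfE.
  apply: CkM => //; first exact: Ck_cst.
  apply: Ck_det => i j; apply: Ck_eq (cF oD (lift b i) (lift a j)) => // u _.
  by rewrite !mxE.
by apply: Ck_eq key => // u Du; rewrite /invmx uF // !mxE.
Qed.

Lemma Ck_row_mx m n p (F : 'rV[R]_N -> 'M[R]_(m, n))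
    (G : 'rV[R]_N -> 'M[R]_(m, p)) :
  Ck k D F -> Ck k D G -> Ck k D (fun u => row_mx (F u) (G u)).
Proof.
move=> cF cG.
have linl : linear (fun B : 'M[R]_(m, n) => row_mx B (0 : 'M[R]_(m, p))).
  by move=> a B C; rewrite scale_row_mx add_row_mx scaler0 addr0.
have linr : linear (fun B : 'M[R]_(m, p) => row_mx (0 : 'M[R]_(m, n)) B).
  by move=> a B C; rewrite scale_row_mx add_row_mx scaler0 addr0.
apply: Ck_eq (CkD oD (Ck_linear linl cF) (Ck_linear linr cG)) => // u _.
by rewrite add_row_mx addr0 add0r.
Qed.

End MatrixCalculus.

Lemma Ck_comp_mx (R : realType) (N N' m n : nat) k (D : set 'rV[R]_N)
    (D' : set 'rV[R]_N') (h : 'rV[R]_N -> 'rV[R]_N')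
    (F : 'rV[R]_N' -> 'M[R]_(m, n)) :
  open D -> open D' -> (forall u, D u -> D' (h u)) ->
  Ck k D h -> Ck k D' F -> Ck k D (fun u => F (h u)).
Proof.
move=> oD oD' hD ch /Ck_mxP cF; apply/Ck_mxP => // i j.
exact: (Ck_comp oD oD' hD ch (cF oD' i j)).
Qed.

Lemma jacobianE (R : realType) (N m : nat) (F : 'rV[R]_N -> 'rV[R]_m) u i j :
  differentiable F u -> ('J F u) i j = ('D_(delta_mx 0 i) F u) 0 j.
Proof. by move=> dF; rewrite mxE deriveE. Qed.

Lemma Ck_jacobian (R : realType) (N m : nat) k (D : set 'rV[R]_N)
    (F : 'rV[R]_N -> 'rV[R]_m) :
  open D -> Ck k.+1 D F -> Ck k D (fun u => 'J F u).
Proof.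
move=> oD [dF sF]; apply/Ck_mxP => // i j.
apply: Ck_eq ((Ck_mxP k _ oD).1 (sF (delta_mx 0 i)) 0 j) => // u Du.
by rewrite jacobianE //; exact: dF.
Qed.

Lemma smooth_derive (R : realType) (N : nat) (V : normedModType R)
    (D : set 'rV[R]_N) (F : 'rV[R]_N -> V) v :
  smooth_on D F -> smooth_on D ('D_v F).
Proof. by move=> sF k; have [_] := sF k.+1; exact. Qed.

Lemma smooth_differentiable (R : realType) (N : nat) (V : normedModType R)
    (D : set 'rV[R]_N) (F : 'rV[R]_N -> V) u :
  smooth_on D F -> D u -> differentiable F u.
Proof. by move=> sF; have [dF _] := sF 1%N; exact: dF. Qed.

(** * Symmetry of second derivatives *)

Section Schwarz.
Variables (R : realType) (N : nat).
Implicit Types (F : 'rV[R]_N -> R^o) (u v w : 'rV[R]_N).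

Lemma line_is_derive F u v (r : R) :
  differentiable F (u + r *: v) ->
  is_derive r 1 (fun s : R => F (u + s *: v)) ('D_v F (u + r *: v)).
Proof.
move=> dF.
have dl : is_diff r (fun s : R => u + s *: v) (fun s => s *: v).
  have -> : (fun s : R => s *: v) = 0 + ( *:%R ^~ v).
    by apply/funext => s; rewrite !fctE add0r.
  exact: is_diffD.
have dc : is_diff r (F \o (fun s : R => u + s *: v))
    ('d F (u + r *: v) \o (fun s : R => s *: v)).
  apply: is_diff_comp; exact: differentiableP.
apply: DeriveDef; first exact/diff_derivable/ex_diff.
rewrite deriveE; last exact: ex_diff.
by rewrite diff_val /= scale1r deriveE.
Qed.

Lemma line_MVT F u v (h : R) : 0 < h ->
  (forall s, 0 <= s <= h -> differentiable F (u + s *: v)) ->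
  exists2 s, 0 < s < h & F (u + h *: v) - F u = 'D_v F (u + s *: v) * h.
Proof.
move=> h0 dF.
have [||s] := @MVT R (fun s => F (u + s *: v)) (fun s => 'D_v F (u + s *: v)) 0 h h0.
- move=> s; rewrite in_itv /= => /andP[s0 sh]; apply: line_is_derive.
  by apply: dF; rewrite (ltW s0) (ltW sh).
- apply: derivable_within_continuous => s; rewrite in_itv /= => sh.
  by have [] := line_is_derive (dF _ sh).
- by rewrite in_itv /= => sh; rewrite scale0r addr0 subr0 => E; exists s.
Qed.

(** Two applications of the mean value theorem, first along [v] to the difference
    of [F] in the direction [w], then along [w] to ['D_v F]. *)
Lemma second_difference_MVT (D : set 'rV[R]_N) F u v w (h : R) :
  0 < h -> Ck 2 D F ->
  (forall s r, 0 <= s <= h -> 0 <= r <= h -> D (u + s *: v + r *: w)) ->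
  exists s r, [/\ 0 <= s <= h, 0 <= r <= h &
    F (u + h *: w + h *: v) - F (u + h *: v) - (F (u + h *: w) - F u) =
    'D_w ('D_v F) (u + s *: v + r *: w) * h * h].
Proof.
move=> h0 [dF sF] inD; have h0' := ltW h0.
have inD0 s : 0 <= s <= h -> D (u + s *: v).
  by move=> sh; have := inD s 0 sh; rewrite lexx h0' scale0r addr0; exact.
have inDh s : 0 <= s <= h -> D (u + h *: w + s *: v).
  by move=> sh; have := inD s h sh; rewrite lexx h0' addrAC; exact.
have dphi s : 0 <= s <= h -> is_derive s 1
    ((fun s : R => F (u + h *: w + s *: v)) - (fun s : R => F (u + s *: v)))
    ('D_v F (u + h *: w + s *: v) - 'D_v F (u + s *: v)).
  by move=> sh; apply: is_deriveB; apply: line_is_derive; apply: dF; auto.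
have dphi' s (sh : s \in `]0, h[%R) := dphi s (subset_itv_oo_cc sh).
have [|s] := MVT h0 dphi'.
  apply: derivable_within_continuous => s; rewrite in_itv /= => sh.
  by have [] := dphi _ sh.
rewrite in_itv /= => /andP[s0 sh]; rewrite !fctE subr0 !scale0r !addr0 => E.
have sh' : 0 <= s <= h by rewrite (ltW s0) (ltW sh).
have [r /andP[r0 rh] E2] := line_MVT h0 (F := 'D_v F) (u := u + s *: v) (v := w)
  (fun r rh => (sF v).1 _ (inD s r sh' rh)).
exists s, r; split => //; first by rewrite (ltW r0) (ltW rh).
by rewrite E [u + _ + _]addrAC E2.
Qed.

(** The second difference of [F] along [v] and [w] is symmetric in [v] and [w], so
    that the two mixed derivatives take a common value at points arbitrarily
    close to [u]; they are continuous, hence equal at [u]. *)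
Lemma derive_commute (D : set 'rV[R]_N) F u v w : open D -> D u ->
  Ck 2 D F -> 'D_w ('D_v F) u = 'D_v ('D_w F) u.
Proof.
move=> oD Du cF.
have tri (x y z : R) : `|x - z| < `|x - y| / 2 -> `|y - z| < `|x - y| / 2 -> false.
  move=> xz yz; rewrite -(ltxx `|x - y|).
  rewrite {1}(_ : x - y = (x - z) - (y - z)); last by ring.
  by rewrite (le_lt_trans (ler_normB _ _)) // [ltRHS]splitr ltrD.
have cA : {for u, continuous ('D_w ('D_v F))} := (cF.2 v).2 w u Du.
have cB : {for u, continuous ('D_v ('D_w F))} := (cF.2 w).2 v u Du.
apply/eqP; apply: contraT => neq.
pose a : R := 'D_w ('D_v F) u; pose b : R := 'D_v ('D_w F) u.
have e0 : 0 < `|a - b| / 2 by rewrite divr_gt0 // normr_gt0 subr_eq0.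
move/cvgrPdist_lt/(_ _ e0) : cA => nA; move/cvgrPdist_lt/(_ _ e0) : cB => nB.
have nD : \forall x \near u, D x by exact: open_nbhs_nbhs.
have nDAB : nbhs u [set x | D x /\ (`|a - 'D_w ('D_v F) x| < `|a - b| / 2 /\
    `|b - 'D_v ('D_w F) x| < `|a - b| / 2)].
  exact: (@filterI _ (nbhs u) _ _ _ nD (@filterI _ (nbhs u) _ _ _ nA nB)).
have [d /= d0 Hd] := (nbhs_ballP _ _).1 nDAB.
(* The parallelogram of side [h] lies in the ball of radius [d]; the summand 1
   avoids a division by zero. *)
pose K := `|v| + `|w| + 1.
have K0 : 0 < K by rewrite ltr_wpDl // addr_ge0.
pose h := d / (2 * K); have h0 : 0 < h by rewrite divr_gt0 // mulr_gt0.
have inB s r v' w' : `|v'| + `|w'| + 1 = K -> 0 <= s <= h -> 0 <= r <= h ->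
    ball u d (u + s *: v' + r *: w').
  move=> KE /andP[s0 sh] /andP[r0 rh]; rewrite -ball_normE /= -addrA opprD addNKr normrN.
  rewrite (le_lt_trans (ler_normD _ _)) // !normrZ !ger0_norm //.
  apply: (@le_lt_trans _ _ (h * K)); last first.
    rewrite /h mulrAC -mulf_div divff ?gt_eqF// mulr1.
    by rewrite ltr_pdivrMr // mulr_natr mulr2n ltrDl.
  rewrite -KE !mulrDr mulr1 -[leLHS]addr0 lerD ?(ltW h0) //.
  by apply: lerD; apply: ler_wpM2r.
have KE' : `|w| + `|v| + 1 = K by rewrite /K [`|w| + _]addrC.
have [s [r [sh rh E1]]] := second_difference_MVT h0 cF
  (fun s r sh rh => (Hd _ (inB s r v w erefl sh rh)).1).
have [s' [r' [sh' rh' E2]]] := second_difference_MVT h0 cF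
  (fun s r sh rh => (Hd _ (inB s r w v KE' sh rh)).1).
pose c : R := 'D_v ('D_w F) (u + s' *: w + r' *: v).
have EE : 'D_w ('D_v F) (u + s *: v + r *: w) = c.
  apply: (mulIf (lt0r_neq0 h0)); apply: (mulIf (lt0r_neq0 h0)).
  apply: etrans (esym E1) _; apply: etrans _ E2.
  rewrite [u + h *: w + _]addrAC.
  move: (F _) (F (u + h *: v)) (F (u + h *: w)) (F u) => x1 x2 x3 x4.
  by rewrite !opprB addrACA [RHS]addrACA [- x2 - x3]addrC.
have [_ [/= A1 _]] := Hd _ (inB s r v w erefl sh rh).
have [_ [/= _ B1]] := Hd _ (inB s' r' w v KE' sh' rh').
have {}A1 : `|a - c| < `|a - b| / 2 by rewrite -EE; exact: A1.
have {}B1 : `|b - c| < `|a - b| / 2 := B1.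
exact: (tri a b c A1 B1).
Qed.

End Schwarz.

(** * Transition maps and coordinate fields *)

Lemma jacobian_comp (R : realType) (m n p : nat) (F : 'rV[R]_m -> 'rV[R]_n)
    (G : 'rV[R]_n -> 'rV[R]_p) u :
  differentiable F u -> differentiable G (F u) ->
  'J (G \o F) u = 'J F u *m 'J G (F u).
Proof.
move=> dF dG; apply/row_matrixP => i; rewrite row_mul !rowE.
have dFi := deriveEjacobian (delta_mx 0 i) dF.
rewrite -[in RHS]dFi -[RHS](deriveEjacobian _ dG).
rewrite -[LHS](deriveEjacobian _ (differentiable_comp dF dG)).
rewrite [LHS](deriveE _ (differentiable_comp dF dG)) diff_comp //=.
by rewrite [RHS](deriveE _ dG) (deriveE _ dF).
Qed.

Lemma near_eq_jacobian (R : realType) (m n : nat) (F G : 'rV[R]_m -> 'rV[R]_n) u :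
  (\forall v \near u, F v = G v) -> differentiable F u -> 'J F u = 'J G u.
Proof.
move=> FG dF; have dG := near_eq_differentiable FG dF.
apply/matrixP => i j.
rewrite [LHS](jacobianE i j dF) [RHS](jacobianE i j dG).
exact: (congr1 (fun w : 'rV_n => w 0 j) (near_eq_derive (delta_mx 0 i) FG)).
Qed.

(** The part of the manifold axioms which only concerns the charts, and which
    does not refer to a topology given beforehand.  The tensor bundle is an atlas
    on a bare type, to which these conditions still apply. *)
Record compatible_charts (R : realType) N (T : Type) (A : atlas R N T) : Prop := {
  chart_coordK : forall (a : index A) p, dom a p -> point a (coord a p) = p ;
  chart_overlap_open : forall a b : index A, open (overlap a b) ;
  chart_transition_smooth :
    forall a b : index A, smooth_on (overlap a b) (transition a b) }.

Section Charts.
Variables (R : realType) (N : nat) (T : Type) (A : atlas R N T).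
Hypothesis cA : compatible_charts A.
Implicit Types (a b c : index A) (u v : 'rV[R]_N).

Lemma cdom_point a u : cdom a u -> dom a (point a u).
Proof. by case=> p ap <-; rewrite (chart_coordK cA). Qed.

Lemma cdom_pointK a u : cdom a u -> coord a (point a u) = u.
Proof. by case=> p ap <-; rewrite (chart_coordK cA). Qed.

Lemma overlap_id a : overlap a a = cdom a.
Proof.
by apply/seteqP; split=> u; [case|split=> //; exact: cdom_point].
Qed.

Lemma cdom_open a : open (cdom a).
Proof. by rewrite -overlap_id; exact: (chart_overlap_open cA). Qed.

Lemma point_transition a b u :
  overlap a b u -> point b (transition a b u) = point a u.
Proof. by case=> _; exact: (chart_coordK cA). Qed.

Lemma overlap_transition a b c u :
  overlap a b u -> overlap a c u -> overlap b c (transition a b u).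
Proof.
move=> ab [_ /= ac]; split; first by case: ab => _ ub; exists (point a u).
by rewrite /preimage /= point_transition.
Qed.

Lemma transition_comp a b c u :
  overlap a b u -> transition b c (transition a b u) = transition a c u.
Proof. by move=> ab; rewrite /transition -/(transition a b u) point_transition. Qed.

Lemma transition_id a u : cdom a u -> transition a a u = u.
Proof. exact: cdom_pointK. Qed.

Lemma overlap_cdom a b u : overlap a b u -> overlap a a u.
Proof. by rewrite overlap_id => -[]. Qed.

Lemma overlap_rev a b u : overlap a b u -> overlap b a (transition a b u).
Proof. by move=> ab; apply: overlap_transition => //; exact: overlap_cdom ab. Qed.

Lemma transition_differentiable a b u :
  overlap a b u -> differentiable (transition a b) u.
Proof.
move=> ab; exact: smooth_differentiable (chart_transition_smooth cA a b) ab.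
Qed.

(** Cocycle condition, the chain rule for the composition of two transition
    maps. *)
Lemma jacobian_transition_comp a b c u : overlap a b u -> overlap a c u ->
  'J (transition a c) u =
  'J (transition a b) u *m 'J (transition b c) (transition a b u).
Proof.
move=> ab ac; rewrite -jacobian_comp; first 1 last.
- exact: transition_differentiable.
- by apply: transition_differentiable; exact: overlap_transition.
apply: near_eq_jacobian; last exact: transition_differentiable.
near=> v; rewrite /= transition_comp //; near: v.
by apply: open_nbhs_nbhs; split=> //; exact: (chart_overlap_open cA).
Unshelve. all: by end_near. Qed.

Lemma jacobian_transition_id a u : cdom a u -> 'J (transition a a) u = 1%:M.
Proof.
move=> au; rewrite (@near_eq_jacobian _ _ _ _ id).
- apply/matrixP => i j; rewrite jacobianE; last exact: ex_diff.
  by rewrite derive_id !mxE eqxx eq_sym.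
- near=> v; apply: transition_id; near: v.
  by apply: open_nbhs_nbhs; split=> //; exact: cdom_open.
- by apply: transition_differentiable; rewrite overlap_id.
Unshelve. all: by end_near. Qed.

Lemma jacobian_transition_unit a b u :
  overlap a b u -> 'J (transition a b) u \in unitmx.
Proof.
move=> ab; have aa := overlap_cdom ab.
have E : 'J (transition a b) u *m 'J (transition b a) (transition a b u) = 1%:M.
  by rewrite -(jacobian_transition_comp ab aa) jacobian_transition_id //; case: ab.
exact: (mulmx1_unit E).1.
Qed.

(** The push-forward to every chart of the vector [v], regarded as a constant
    field in the chart [a]. *)
Definition constant_field a v : vector_field A :=
  fun b u => 'D_v (transition a b) (transition b a u).

Lemma constant_fieldE a v u : cdom a u -> constant_field a v a u = v.
Proof.
move=> au; rewrite /constant_field transition_id //.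
have aa : overlap a a u by rewrite overlap_id.
rewrite deriveEjacobian ?jacobian_transition_id ?mulmx1 //.
exact: transition_differentiable.
Qed.

Lemma dom_atlas_open a : atlas_open A (dom a).
Proof. by move=> b; exact: (chart_overlap_open cA). Qed.

(** The field has the components ['D_v (transition a b)] in the chart [b], read at
    the point with coordinates [transition b a u]; both maps are smooth, and the
    change of components from [b] to [c] is the cocycle condition. *)
Lemma constant_field_on a v : vector_field_on (dom a) (constant_field a v).
Proof.
split=> [b k|b c u ba /= uc].
  have sD := smooth_derive v (chart_transition_smooth cA a b).
  apply: (Ck_comp_mx (D' := overlap a b)) (sD k).
  - exact: (chart_overlap_open cA).
  - exact: (chart_overlap_open cA).
  - by move=> u; exact: overlap_rev.
  - exact: (chart_transition_smooth cA).
have {}ba : overlap b a u := ba.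
have bc : overlap b c u by split=> //; case: ba.
have ab := overlap_rev ba.
have ac : overlap a c (transition b a u) by exact: overlap_transition.
rewrite /constant_field transition_comp //.
rewrite [LHS](deriveEjacobian v (transition_differentiable ac)).
rewrite [in RHS](deriveEjacobian v (transition_differentiable ab)).
have bab : transition a b (transition b a u) = u.
  by rewrite (transition_comp b ba) transition_id //; case: ba.
by rewrite [in LHS](jacobian_transition_comp ab ac) mulmxA bab.
Qed.

End Charts.

(** The overlap of two charts is the inverse image of an open subset of the
    manifold under a parametrization, which is continuous on its open domain. *)
Lemma manifold_charts (R : realType) (n : nat) (M : topologicalType)
    (A : atlas R n M) : smooth_manifold A -> compatible_charts A.
Proof.
move=> hM; split.
- exact: manifold_coordK.
- move=> a b; rewrite /overlap /chart_part.
  have /continuousP := manifold_point_continuous hM (a := a).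
  move=> /(_ _ (manifold_dom_open hM b)) /open_subspaceP[V oV VE].
  by rewrite setIC -VE; apply: openI => //; exact: manifold_cdom_open hM a.
- exact: manifold_transition_smooth.
Qed.

(** * Charts of the tensor bundle *)

Lemma mxvec_linear (R : pzRingType) n : linear (mxvec : 'M[R]_n -> 'rV[R]_(n * n)).
Proof. by move=> c B C; rewrite linearP. Qed.

Lemma invmxM (R : comUnitRingType) n (B C : 'M[R]_n) : B \in unitmx -> C \in unitmx ->
  invmx (B *m C) = invmx C *m invmx B.
Proof.
move=> uB uC; have uBC : B *m C \in unitmx by rewrite unitmx_mul uB.
apply: (can_inj (mulKmx uBC)).
by rewrite mulmxV // mulmxA -(mulmxA B) mulmxV // mulmx1 mulmxV.
Qed.

Section BundleCharts.
Variables (R : realType) (n : nat) (M : Type) (A : atlas R n M).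
Hypothesis cA : compatible_charts A.
Implicit Types (a b c : index A) (w : 'rV[R]_(n + n * n)) (t : 'M[R]_n).

Lemma tensor_change_id a x t : cdom a x -> tensor_change a a x t = t.
Proof.
by move=> ax; rewrite /tensor_change jacobian_transition_id // trmx1 invmx1 mul1mx mulmx1.
Qed.

(** Follows from the cocycle condition of the Jacobian matrices; it is what makes
    the components of a tensor in all charts a consistent family. *)
Lemma tensor_change_comp a b c x t : overlap a b x -> overlap a c x ->
  tensor_change b c (transition a b x) (tensor_change a b x t) =
  tensor_change a c x t.
Proof.
move=> ab ac; rewrite /tensor_change [in RHS](jacobian_transition_comp cA ab ac).
rewrite trmx_mul invmxM ?unitmx_tr ?jacobian_transition_unit //; last first.
  exact: overlap_transition.
by rewrite !mulmxA.
Qed.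

Lemma bundle_point_dom a w : cdom a (bcoord w) ->
  @dom _ _ _ (bundle11 A) a (@point _ _ _ (bundle11 A) a w).
Proof.
move=> aw; have ap := cdom_point cA aw; have E := cdom_pointK cA aw.
split=> //=; split=> [b nb|b c bw cw]; first by rewrite (asboolF nb).
rewrite (asboolT bw) (asboolT cw).
have ab : overlap a b (bcoord w) by split.
have ac : overlap a c (bcoord w) by split.
exact: (esym (tensor_change_comp _ ab ac)).
Qed.

Lemma bundle_cdomE a :
  @cdom _ _ _ (bundle11 A) a = [set w | cdom a (bcoord w)].
Proof.
apply/seteqP; split=> [w|w /= aw].
  by case=> q [aq tq] <-; rewrite /= /bcoord row_mxKl; exists q.1.
exists (@point _ _ _ (bundle11 A) a w); first exact: bundle_point_dom.
rewrite /= (cdom_pointK cA aw) (asboolT (cdom_point cA aw)).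
by rewrite tensor_change_id // vec_mxK hsubmxK.
Qed.

Lemma bcoord_linear : linear (@bcoord R n).
Proof. by move=> k v w; rewrite /bcoord linearP. Qed.

Lemma fcoord_linear : linear (@fcoord R n).
Proof. by move=> k v w; rewrite /fcoord !linearP. Qed.

Lemma Ck_bcoord k (D : set 'rV[R]_(n + n * n)) : open D -> Ck k D (@bcoord R n).
Proof. by move=> oD; apply: (Ck_linear oD bcoord_linear (Ck_id k oD)). Qed.

Lemma Ck_fcoord k (D : set 'rV[R]_(n + n * n)) : open D -> Ck k D (@fcoord R n).
Proof. by move=> oD; apply: (Ck_linear oD fcoord_linear (Ck_id k oD)). Qed.

Lemma open_bcoord (D : set 'rV[R]_n) :
  open D -> open [set w : 'rV[R]_(n + n * n) | D (bcoord w)].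
Proof.
by move=> oD; apply: open_comp => // w _; exact: continuous_lsubmx.
Qed.

Lemma bundle_overlapE a b :
  @overlap _ _ _ (bundle11 A) a b = [set w | overlap a b (bcoord w)].
Proof.
rewrite /overlap /chart_part bundle_cdomE; apply/seteqP; split=> w.
  by case=> aw [bw _]; split.
case=> aw bw; split=> //; split=> //.
by have [_] := bundle_point_dom aw.
Qed.

Lemma bundle_transitionE a b w : overlap a b (bcoord w) ->
  @transition _ _ _ (bundle11 A) a b w =
  row_mx (transition a b (bcoord w))
         (mxvec (tensor_change a b (bcoord w) (fcoord w))).
Proof. by case=> aw bw; rewrite {1}/transition /= (asboolT bw). Qed.

Lemma Ck_tensor_change k a b :
  Ck k [set w | overlap a b (bcoord w)]
    (fun w => tensor_change a b (bcoord w) (fcoord w)).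
Proof.
have oab : open (overlap a b) by exact: (chart_overlap_open cA).
have oD := open_bcoord oab.
have ltr : linear (trmx : 'M[R]_n -> 'M[R]_n) by move=> c B C; rewrite linearP.
have cJ : Ck k [set w | overlap a b (bcoord w)]
    (fun w => ('J (transition a b) (bcoord w))^T).
  apply: (Ck_linear oD ltr).
  have cJ := Ck_jacobian oab (chart_transition_smooth cA a b k.+1).
  exact: (Ck_comp_mx oD oab (fun w abw => abw) (Ck_bcoord k oD) cJ).
apply: Ck_mulmx => //; first apply: Ck_mulmx => //.
  exact: Ck_fcoord.
apply: Ck_invmx => // w ab.
by rewrite unitmx_tr; exact: jacobian_transition_unit.
Qed.

(** A transition map of the bundle acts on base coordinates by a transition map of
    [M], and on fibre coordinates by a conjugation with its Jacobian matrix. *)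
Lemma bundle_charts : compatible_charts (bundle11 A).
Proof.
split.
- move=> a [p t] [/= ap tp]; rewrite /bcoord /fcoord row_mxKl row_mxKr mxvecK.
  rewrite (chart_coordK cA) //; congr (_, _); apply/funext => b.
  have [bp|nb] := pselect (dom b p); last by rewrite (asboolF nb) tp.1.
  by rewrite (asboolT bp) (tp.2 a b).
- by move=> a b; rewrite bundle_overlapE; exact/open_bcoord/(chart_overlap_open cA).
- move=> a b k; rewrite bundle_overlapE.
  have oab : open (@overlap _ _ _ A a b) by exact: (chart_overlap_open cA).
  have oD := open_bcoord oab.
  have cb := Ck_bcoord k oD.
  have ct := Ck_comp_mx oD oab (fun w => id) cb (chart_transition_smooth cA a b k).
  have cf := Ck_linear oD (@mxvec_linear R n) (Ck_tensor_change k a b).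
  apply: Ck_eq (Ck_row_mx oD ct cf) => // w ab.
  exact/esym/bundle_transitionE.
Qed.

End BundleCharts.

(** * Derivatives of matrix-valued maps *)

Section MatrixDerivatives.
Variables (R : realType) (V : normedModType R).
Implicit Types (x v : V).

Lemma is_derive_mxP m n (M : V -> 'M[R]_(m, n)) (dM : 'M[R]_(m, n)) x v :
  is_derive x v M dM <->
  forall i j, is_derive x v (fun y => M y i j) (dM i j).
Proof.
split=> [[dv <-] i j|H].
  by apply: DeriveDef; [exact: (derivable_mxP M x v).1|rewrite derive_mx // mxE].
have dv : derivable M x v by apply/derivable_mxP => i j; case: (H i j).
apply: DeriveDef => //; apply/matrixP => i j; rewrite derive_mx // mxE.
by case: (H i j).
Qed.

Lemma is_derive_finite_sum (W : normedModType R) n (h : 'I_n -> V -> W) x v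
    (dh : 'I_n -> W) : (forall i, is_derive x v (h i) (dh i)) ->
  is_derive x v (fun y => \sum_i h i y) (\sum_i dh i).
Proof.
move=> H; have -> : (fun y => \sum_i h i y) = \sum_i h i.
  by apply/funext => y; rewrite fct_sumE.
exact: is_derive_sum.
Qed.

Lemma is_derive_mulmx m n p (F : V -> 'M[R]_(m, n)) (H : V -> 'M[R]_(n, p))
    dF dH x v : is_derive x v F dF -> is_derive x v H dH ->
  is_derive x v (fun y => F y *m H y) (dF *m H x + F x *m dH).
Proof.
move=> /is_derive_mxP cF /is_derive_mxP cH; apply/is_derive_mxP => i j.
have -> : (fun y => (F y *m H y) i j) = (fun y => \sum_k F y i k * H y k j).
  by apply/funext => y; rewrite mxE.
have <- : \sum_k (F x i k * dH k j + H x k j * dF i k) =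
          (dF *m H x + F x *m dH) i j.
  rewrite !mxE -big_split; apply: eq_bigr => k _ /=.
  by rewrite addrC [H x k j * _]mulrC.
apply: is_derive_finite_sum => k.
exact: (is_deriveM (cF i k) (cH k j)).
Qed.

Lemma is_derive_scale_mx m n (h : V -> R) (F : V -> 'M[R]_(m, n))
    dh dF x v : is_derive x v h dh -> is_derive x v F dF ->
  is_derive x v (fun y => h y *: F y) (dh *: F x + h x *: dF).
Proof.
move=> hh /is_derive_mxP hF; apply/is_derive_mxP => i j.
have -> : (fun y => (h y *: F y) i j) = h * (fun y => F y i j).
  by apply/funext => y; rewrite mxE.
apply: (is_derive_eq (is_deriveM hh (hF i j))).
by rewrite !mxE addrC /GRing.scale /= [F x i j * _]mulrC.
Qed.

Lemma is_derive_linear m n p q (L : 'M[R]_(m, n) -> 'M[R]_(p, q)) F dF x v :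
  linear L -> is_derive x v F dF -> is_derive x v (fun y => L (F y)) (L dF).
Proof.
move=> linL /is_derive_mxP cF; apply/is_derive_mxP => a b.
pose Lm := GRing.isLinear.Build _ _ _ _ L linL.
pose L' : {linear 'M[R]_(m, n) -> 'M[R]_(p, q)} := HB.pack L Lm.
have LE (B : 'M[R]_(m, n)) :
    L B a b = \sum_i \sum_j L' (delta_mx i j) a b * B i j.
  rewrite -[L B]/(L' B) [in LHS](matrix_sum_delta B) linear_sum summxE.
  apply: eq_bigr => i _; rewrite linear_sum summxE.
  by apply: eq_bigr => j _; rewrite linearZ mxE mulrC.
rewrite LE; have -> : (fun y => L (F y) a b) =
    (fun y => \sum_i \sum_j L' (delta_mx i j) a b * F y i j).
  by apply/funext => y; rewrite LE.
apply: is_derive_finite_sum => i; apply: is_derive_finite_sum => j.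
Qed.

Lemma is_derive_trace n (F : V -> 'M[R]_n) dF x v : is_derive x v F dF ->
  is_derive x v (fun y => \tr (F y)) (\tr dF).
Proof.
move=> /is_derive_mxP cF; apply: is_derive_finite_sum => i; exact: cF.
Qed.

Lemma is_derive_row_mx m n p (F : V -> 'M[R]_(m, n)) (H : V -> 'M[R]_(m, p))
    dF dH x v : is_derive x v F dF -> is_derive x v H dH ->
  is_derive x v (fun y => row_mx (F y) (H y)) (row_mx dF dH).
Proof.
move=> /is_derive_mxP cF /is_derive_mxP cH; apply/is_derive_mxP => i j.
case: (split_ordP j) => k ->.
  by under eq_fun do rewrite row_mxEl; rewrite row_mxEl; exact: cF.
by under eq_fun do rewrite row_mxEr; rewrite row_mxEr; exact: cH.
Qed.

(** Obtained by deriving [F * F^-1 = 1]. *)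
Lemma is_derive_invmx n (F : V -> 'M[R]_n) dF x v :
  (\forall y \near x, F y \in unitmx) -> is_derive x v F dF ->
  derivable (fun y => invmx (F y)) x v ->
  is_derive x v (fun y => invmx (F y)) (- (invmx (F x) *m dF *m invmx (F x))).
Proof.
move=> uF hF /derivableP hI; apply: (is_derive_eq hI).
have uFx := nbhs_singleton uF.
have [_ E] := is_derive_mulmx hF hI.
have : 'D_v (fun y => F y *m invmx (F y)) x = 0.
  rewrite -(derive_cst (1%:M : 'M[R]_n) x v); apply: near_eq_derive.
  near=> y; rewrite mulmxV //; near: y; exact: uF.
rewrite E => /(congr1 (mulmx (invmx (F x)))); rewrite mulmx0 mulmxDr mulKmx // mulmxA.
by move/eqP; rewrite addrC addr_eq0 => /eqP.
Unshelve. all: by end_near. Qed.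

End MatrixDerivatives.

Lemma differentiable_is_derive (R : realType) (V W : normedModType R)
    (F : V -> W) x v : differentiable F x -> is_derive x v F ('D_v F x).
Proof. by move=> dF; apply/derivableP/diff_derivable. Qed.

(** The difference quotients of [F \o L] along [v] are those of [F] along [L v]. *)
Lemma is_derive_comp_linear (R : realType) (V V' W : normedModType R)
    (L : V -> V') (F : V' -> W) x v dF : linear L ->
  is_derive (L x) (L v) F dF -> is_derive x v (F \o L) dF.
Proof.
move=> linL [dv <-].
have E : (fun h : R => h^-1 *: (((F \o L) \o shift x) (h *: v) - (F \o L) x)) =
         (fun h : R => h^-1 *: ((F \o shift (L x)) (h *: L v) - F (L x))).
  by apply/funext => h /=; rewrite linL.
by apply: DeriveDef; rewrite /derivable /derive E.
Qed.

Lemma derive_partial (R : realType) N (F : 'rV[R]_N -> R^o) x v :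
  differentiable F x -> 'D_v F x = \sum_i v 0 i * partial i F x.
Proof.
move=> dF; rewrite /partial deriveE // [in LHS](row_sum_delta v) linear_sum.
by apply: eq_bigr => i _; rewrite linearZ /= -deriveE.
Qed.

(** * The Levi-Civita connection in a chart *)

Section Connection.
Variables (R : realType) (N : nat).
Implicit Types (G : 'rV[R]_N -> 'M[R]_N) (x X Y : 'rV[R]_N).

(** The connection form: the endomorphism [Y |-> Gamma(X, Y)], acting on column
    vectors. *)
Definition conn_mx G x X : 'M[R]_N :=
  \matrix_(i, m) \sum_s X 0 s * christoffel G x i s m.

Lemma conn_mx_is_linear G x : linear (conn_mx G x).
Proof.
move=> k X Y; apply/matrixP => i m; rewrite !mxE mulr_sumr -big_split.
by apply: eq_bigr => s _; rewrite !mxE mulrDl mulrA.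
Qed.

HB.instance Definition _ G x :=
  GRing.isLinear.Build R 'rV[R]_N 'M[R]_N _ (conn_mx G x) (conn_mx_is_linear G x).

Lemma conn_mx_torsion G x X Y : (\forall v \near x, (G v)^T = G v) ->
  Y *m (conn_mx G x X)^T = X *m (conn_mx G x Y)^T.
Proof.
move=> symG; apply/rowP => k; rewrite !mxE.
under eq_bigr do rewrite !mxE mulr_sumr.
rewrite exchange_big; apply: eq_bigr => i _; rewrite !mxE mulr_sumr.
apply: eq_bigr => j _; rewrite (christoffel_sym _ _ _ symG).
by rewrite mulrCA.
Qed.

(** The identity [christoffel_metric], contracted with the components of [X]. *)
Lemma conn_mx_metric G x X : differentiable G x -> G x \in unitmx ->
  (\forall v \near x, (G v)^T = G v) ->
  is_derive x X G ((conn_mx G x X)^T *m G x + G x *m conn_mx G x X).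
Proof.
move=> dG uG symG; have [dv _] := differentiable_is_derive X dG.
apply: DeriveDef => //; rewrite derive_mx //; apply/matrixP => i j.
have dGij : differentiable (fun v => G v i j : R^o) x.
  apply: (@differentiable_comp _ _ _ _ G (fun M : 'M[R]_N => M i j : R^o)) => //.
  exact: differentiable_coord.
rewrite mxE (derive_partial _ dGij) !mxE.
under eq_bigr => k _ do rewrite (christoffel_metric _ _ _ uG symG) mulr_sumr.
rewrite exchange_big -big_split; apply: eq_bigr => m _ /=.
rewrite !mxE mulr_suml mulr_sumr -big_split; apply: eq_bigr => k _ /=.
by ring.
Qed.

(** The Levi-Civita derivative in a chart, which depends on the first field only
    through its value [X] at [x]. *)
Definition cov G x X (Y : 'rV[R]_N -> 'rV[R]_N) : 'rV[R]_N :=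
  'D_X Y x + Y x *m (conn_mx G x X)^T.

Lemma levi_civitaE T (A : atlas R N T) (g : metric_field A) (X Y : vector_field A)
    a u : levi_civita g X Y a u = cov (g a) u (X a u) (Y a).
Proof.
congr (_ + _); apply/rowP => k; rewrite !mxE exchange_big.
apply: eq_bigr => j _; rewrite !mxE mulr_sumr; apply: eq_bigr => i _.
by ring.
Qed.

Lemma cov_linear G x (Y : 'rV[R]_N -> 'rV[R]_N) :
  differentiable Y x -> linear (fun X => cov G x X Y).
Proof.
move=> dY k X X'; rewrite /cov !deriveE // !linearP /= scalerDr addrACA.
by congr (_ + _); rewrite linearP /= scalemxAr mulmxDr.
Qed.

(** The Christoffel terms cancel by symmetry. *)
Lemma cov_torsion G x (X Y : 'rV[R]_N -> 'rV[R]_N) :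
  (\forall v \near x, (G v)^T = G v) ->
  cov G x (X x) Y - cov G x (Y x) X = 'D_(X x) Y x - 'D_(Y x) X x.
Proof.
by move=> symG; rewrite /cov (conn_mx_torsion _ _ symG) [in LHS]opprD addrACA subrr addr0.
Qed.

Lemma metric_formDl (B : 'M[R]_N) (v v' w : 'rV[R]_N) :
  metric_form B (v + v') w = metric_form B v w + metric_form B v' w.
Proof. by rewrite /metric_form !mulmxDl mxE. Qed.

Lemma metric_formDr (B : 'M[R]_N) (v w w' : 'rV[R]_N) :
  metric_form B v (w + w') = metric_form B v w + metric_form B v w'.
Proof. by rewrite /metric_form linearD mulmxDr mxE. Qed.

Lemma metric_formC (B : 'M[R]_N) (v w : 'rV[R]_N) :
  B^T = B -> metric_form B v w = metric_form B w v.
Proof.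
move=> symB; rewrite /metric_form -[in RHS](trmxK (w *m B *m v^T)) [in RHS]mxE.
by rewrite !trmx_mul trmxK symB mulmxA.
Qed.

(** Leibniz rule for [Y G Z^T], where the derivative of [G] is given by
    [conn_mx_metric]. *)
Lemma cov_metric G x X (Y Z : 'rV[R]_N -> 'rV[R]_N) :
  differentiable G x -> G x \in unitmx -> (\forall v \near x, (G v)^T = G v) ->
  differentiable Y x -> differentiable Z x ->
  'D_X (fun v => metric_form (G v) (Y v) (Z v) : R^o) x =
  metric_form (G x) (cov G x X Y) (Z x) + metric_form (G x) (Y x) (cov G x X Z).
Proof.
move=> dG uG symG dY dZ.
have hG := conn_mx_metric X dG uG symG.
have hY := differentiable_is_derive X dY.
have ltr : linear (trmx : 'rV[R]_N -> 'cV[R]_N) by move=> c B C; rewrite linearP.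
have hZ := is_derive_linear ltr (differentiable_is_derive X dZ).
have /is_derive_mxP/(_ 0 0) := is_derive_mulmx (is_derive_mulmx hY hG) hZ.
case=> _ E; apply: etrans E _; rewrite /cov /metric_form.
set dYx := 'D_X Y x; set dZx := 'D_X Z x; set c := conn_mx G x X.
have mxD (B C : 'M[R]_1) : B 0 0 + C 0 0 = (B + C) 0 0 by rewrite mxE.
rewrite mxD; congr (fun_of_matrix _ _ _).
have trD (B C : 'rV[R]_N) : (B + C)^T = B^T + C^T by rewrite linearD.
rewrite trD !trmx_mul trmxK !mulmxDl !mulmxDr !mulmxA.
by rewrite !mulmxDl -!addrA [X in _ + (_ + X)]addrC.
Qed.

End Connection.

(** * The curvature as a matrix *)

(** It suffices to commute with the elementary matrices. *)
Lemma commuting_scalar_mx (R : comNzRingType) n (B : 'M[R]_n) :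
  (forall t : 'M[R]_n, t *m B = B *m t) -> is_scalar_mx B.
Proof.
move=> cB.
have E i j k l : (k == i)%:R * B j l = B k i * (j == l)%:R.
  have /matrixP/(_ k l) := cB (delta_mx i j).
  rewrite !mxE (bigD1 j) //= big1 => [|m mj]; last by rewrite mxE (negbTE mj) andbF mul0r.
  rewrite (bigD1 i) //= big1 => [|m mi]; last by rewrite mxE (negbTE mi) mulr0.
  by rewrite !mxE !eqxx andbT !addr0 [l == j]eq_sym.
case: n B cB E => [|n] B cB E; first by apply/is_scalar_mxP; exists 0; apply/matrixP => -[].
apply/is_scalar_mxP; exists (B 0 0); apply/matrixP => i j; rewrite mxE.
have := E 0 i 0 j; rewrite eqxx mul1r => ->.
by rewrite mulr_natr.
Qed.

Lemma derive_commute_mx (R : realType) N m n (D : set 'rV[R]_N)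
    (F : 'rV[R]_N -> 'M[R]_(m, n)) u v w :
  open D -> D u -> smooth_on D F -> 'D_w ('D_v F) u = 'D_v ('D_w F) u.
Proof.
move=> oD Du sF; apply/matrixP => i j.
have dE v' x : D x -> ('D_v' F x) i j = 'D_v' (fun y => F y i j : R^o) x.
  move=> Dx; rewrite derive_mx ?mxE //.
  exact/diff_derivable/(smooth_differentiable sF Dx).
have dDE v' w' : ('D_w' ('D_v' F) u) i j = 'D_w' ('D_v' (fun y => F y i j : R^o)) u.
  have d2 : derivable ('D_v' F) u w'.
    exact/diff_derivable/(smooth_differentiable (smooth_derive v' sF) Du).
  rewrite [in LHS](derive_mx d2) mxE; apply: near_eq_derive.
  by near=> x; apply: dE; near: x; exact: open_nbhs_nbhs.
rewrite [LHS]dDE [RHS]dDE.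
by apply: (derive_commute _ _ oD Du); exact: ((Ck_mxP 2 _ oD).1 (sF 2) i j).
Unshelve. all: by end_near. Qed.

(** Proves identities in the additive group of matrices, the products being
    treated as atoms. *)
Ltac mx_abelian :=
  repeat match goal with
  | |- context [@mulmx ?S ?m ?n ?p ?B ?C] =>
    let q := fresh "q" in set q := (@mulmx S m n p B C); clearbody q
  end; let i := fresh "i" in let j := fresh "j" in
  apply/matrixP => i j; rewrite !mxE; ring.

Section Curvature.
Variables (R : realType) (N : nat) (D : set 'rV[R]_N) (G : 'rV[R]_N -> 'M[R]_N).
Hypotheses (oD : open D) (sG : smooth_on D G).
Hypotheses (symG : forall x, D x -> (G x)^T = G x).
Hypotheses (unitG : forall x, D x -> G x \in unitmx).
Implicit Types (x X Y : 'rV[R]_N).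

Lemma near_sym x : D x -> \forall v \near x, (G v)^T = G v.
Proof.
by move=> Dx; near=> v; apply: symG; near: v; exact: open_nbhs_nbhs.
Unshelve. all: by end_near. Qed.

Lemma Ck_christoffel k i j l : Ck k D (fun x => christoffel G x i j l : R^o).
Proof.
have sp a b c : Ck k D (partial a (fun v => G v b c) : _ -> R^o).
  have sGbc : smooth_on D (fun v => G v b c : R^o).
    by move=> k'; exact: ((Ck_mxP k' _ oD).1 (sG k') b c).
  exact: (smooth_derive _ sGbc).
apply: CkM => //; first exact: Ck_cst.
apply: Ck_sum => // m _; apply: CkM => //.
  exact: ((Ck_mxP k _ oD).1 (Ck_invmx oD unitG (sG k)) i m).
apply: CkD => //; first exact: CkD.
apply: Ck_eq (CkM oD (Ck_cst k D (-1 : R^o)) (sp m j l)) => // x _.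
by rewrite mulN1r.
Qed.

Lemma smooth_conn_mx Y : smooth_on D (fun x => conn_mx G x Y).
Proof.
move=> k; apply/Ck_mxP => // i m.
have key : Ck k D (fun x => \sum_s Y 0 s * christoffel G x i s m : R^o).
  apply: Ck_sum => // s _; apply: CkM => //; first exact: Ck_cst.
  exact: Ck_christoffel.
by apply: Ck_eq key => // x _; rewrite mxE.
Qed.

(** The curvature endomorphism [R(X, Y)] as the matrix [dA + A ^ A], where [A] is
    the connection form. *)
Definition curv_mx x X Y : 'M[R]_N :=
  'D_X (fun v => conn_mx G v Y) x - 'D_Y (fun v => conn_mx G v X) x +
  (conn_mx G x X *m conn_mx G x Y - conn_mx G x Y *m conn_mx G x X).

Lemma derive_metric x X : D x ->
  'D_X G x = (conn_mx G x X)^T *m G x + G x *m conn_mx G x X.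
Proof.
move=> Dx; have dG := smooth_differentiable sG Dx.
by have [_ ->] := conn_mx_metric X dG (unitG Dx) (near_sym Dx).
Qed.

(** Deriving [D_X G = A_X^T G + G A_X] once more along [Y] and antisymmetrizing in
    [X] and [Y] leaves [R^T G + G R] on one side, and zero on the other by the
    symmetry of second derivatives. *)
Lemma curv_mx_skew x X Y : D x ->
  (curv_mx x X Y)^T *m G x + G x *m curv_mx x X Y = 0.
Proof.
move=> Dx.
have ltr : linear (trmx : 'M[R]_N -> 'M[R]_N) by move=> c B C; rewrite linearP.
have d2 U W : 'D_W ('D_U G) x =
    (('D_W (fun v => conn_mx G v U) x)^T *m G x + (conn_mx G x U)^T *m 'D_W G x) +
    ('D_W G x *m conn_mx G x U + G x *m 'D_W (fun v => conn_mx G v U) x).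
  have hc := differentiable_is_derive W (smooth_differentiable (smooth_conn_mx U) Dx).
  have hG := differentiable_is_derive W (smooth_differentiable sG Dx).
  have [_ <-] := is_deriveD (is_derive_mulmx (is_derive_linear ltr hc) hG)
    (is_derive_mulmx hG hc).
  apply: near_eq_derive; near=> v; apply: derive_metric; near: v.
  exact: open_nbhs_nbhs.
have /eqP := derive_commute_mx (u := x) Y X oD Dx sG.
rewrite [X in X == _]d2 [X in _ == X]d2 !derive_metric // /curv_mx.
set dXY := 'D_X _ x; set dYX := 'D_Y _ x.
set cX := conn_mx G x X; set cY := conn_mx G x Y; move: (G x) => g.
have trB (B C : 'M[R]_N) : (B - C)^T = B^T - C^T by rewrite linearB.
have trD (B C : 'M[R]_N) : (B + C)^T = B^T + C^T by rewrite linearD.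
rewrite -subr_eq0 => /eqP E; rewrite -[RHS]E {E}.
rewrite trD !trB !trmx_mul !(mulmxDl, mulmxDr, mulmxBl, mulmxBr, mulNmx, mulmxN) !mulmxA.
by clearbody dXY dYX cX cY; clear -g; mx_abelian.
Unshelve. all: by end_near. Qed.

Lemma curv_mxE x X Y l k : D x ->
  curv_mx x X Y l k =
  \sum_i \sum_j X 0 i * Y 0 j * riemann G x l k i j.
Proof.
move=> Dx.
have dG p q r : differentiable (fun v => christoffel G v p q r : R^o) x.
  exact: (Ck_christoffel 1 p q r).1 x Dx.
have dC (U W : 'rV[R]_N) : ('D_U (fun v => conn_mx G v W) x) l k =
    \sum_i \sum_j U 0 i * W 0 j * partial i (fun v => christoffel G v l j k) x.
  rewrite derive_mx; last first.
    exact/diff_derivable/(smooth_differentiable (smooth_conn_mx W) Dx).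
  rewrite mxE exchange_big /=.
  transitivity ('D_U (fun v => \sum_s W 0 s *: (christoffel G v l s k : R^o)) x).
    apply: (congr1 (fun F : 'rV[R]_N -> R^o => 'D_U F x)).
    by apply/funext => v; rewrite mxE.
  have [_ ->] := is_derive_finite_sum (fun s => is_deriveZ (W 0 s)
     (differentiable_is_derive U (dG l s k))).
  apply: eq_bigr => s _; rewrite (derive_partial _ (dG l s k)) scaler_sumr.
  by apply: eq_bigr => i _; rewrite /GRing.scale /= mulrCA mulrA.
have cC (U W : 'rV[R]_N) : (conn_mx G x U *m conn_mx G x W) l k =
    \sum_i \sum_j U 0 i * W 0 j *
      \sum_m christoffel G x l i m * christoffel G x m j k.
  rewrite mxE; under eq_bigr => m _ do rewrite !mxE big_distrlr /=.
  rewrite exchange_big; apply: eq_bigr => i _ /=.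
  rewrite exchange_big; apply: eq_bigr => j _ /=; rewrite mulr_sumr.
  by apply: eq_bigr => m _; rewrite mulrACA.
rewrite mxE [X in X + _]mxE [X in _ + X]mxE [X in (_ + X) + _]mxE [X in _ + (_ + X)]mxE.
rewrite !cC !dC [X in (_ - X) + _]exchange_big [X in _ + (_ - X)]exchange_big /=.
rewrite -!sumrB -big_split; apply: eq_bigr => i _ /=.
rewrite -!sumrB -big_split; apply: eq_bigr => j _ /=.
by rewrite /riemann sumrB [Y 0 j * _]mulrC -!mulrBr -mulrDr.
Qed.

End Curvature.

(** * The Sasaki metric on horizontal and vertical lifts *)

Section AdaptedFrame.
Variables (R : realType) (n : nat) (D : set 'rV[R]_n).
Variables (G : 'rV[R]_n -> 'M[R]_n) (f : 'rV[R]_n -> R).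
Hypotheses (oD : open D) (sG : smooth_on D G) (sf : smooth_on D (f : _ -> R^o)).
Hypotheses (symG : forall x, D x -> (G x)^T = G x).
Hypotheses (posG : forall x v, D x -> v != 0 -> 0 < metric_form (G x) v v).
Hypotheses (f_gt0 : forall x, D x -> 0 < f x).

Local Notation DD := [set w : 'rV[R]_(n + n * n) | D (bcoord w)].
Local Notation S := (sasaki_mx G f).
Implicit Types (w xi eta : 'rV[R]_(n + n * n)) (x X Y : 'rV[R]_n) (B C : 'M[R]_n).

Lemma metric_unit x : D x -> G x \in unitmx.
Proof.
move=> Dx; rewrite -row_free_unit; apply: inj_row_free => v vG0.
apply/eqP; apply: contraT => v0; have := posG Dx v0.
by rewrite /metric_form vG0 mul0mx mxE ltxx.
Qed.

Lemma bundle_open : open DD.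
Proof. exact: open_bcoord. Qed.

(** The commutator with the connection form turns brackets of horizontal lifts
    into matrix algebra. *)
Lemma hliftE w X : hlift G w X =
  row_mx X (mxvec (fcoord w *m conn_mx G (bcoord w) X -
                   conn_mx G (bcoord w) X *m fcoord w)).
Proof.
congr row_mx; congr mxvec; apply/matrixP => i j; rewrite !mxE.
under eq_bigr do rewrite mulr_sumr.
rewrite exchange_big -sumrB; apply: eq_bigr => m _ /=; rewrite !mxE.
rewrite mulr_sumr mulr_suml -sumrB; apply: eq_bigr => s _.
by ring.
Qed.

Lemma smooth_conn_bcoord X : smooth_on DD (fun w => conn_mx G (bcoord w) X).
Proof.
move=> k; have sC := smooth_conn_mx oD sG metric_unit X.
exact: (Ck_comp_mx bundle_open oD (fun w Dw => Dw) (Ck_bcoord k bundle_open) (sC k)).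
Qed.

Lemma smooth_metric_bcoord : smooth_on DD (fun w => G (bcoord w)).
Proof.
move=> k.
exact: (Ck_comp_mx bundle_open oD (fun w Dw => Dw) (Ck_bcoord k bundle_open) (sG k)).
Qed.

Lemma smooth_hlift X : smooth_on DD (fun w => hlift G w X).
Proof.
move=> k; have oDD := bundle_open.
have ct := Ck_fcoord k oDD; have cc := smooth_conn_bcoord X k.
have lN : linear (fun B : 'M[R]_n => - B) by move=> c B C; rewrite opprD scalerN.
have key := Ck_row_mx oDD (Ck_cst k DD X) (Ck_linear oDD (@mxvec_linear R n)
  (CkD oDD (Ck_mulmx oDD ct cc) (Ck_linear oDD lN (Ck_mulmx oDD cc ct)))).
by apply: Ck_eq key => // w _; rewrite hliftE.
Qed.

Lemma is_derive_hlift w xi X : DD w ->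
  is_derive w xi (fun v => hlift G v X)
    (vlift (fcoord xi *m conn_mx G (bcoord w) X - conn_mx G (bcoord w) X *m fcoord xi +
      (fcoord w *m 'D_(bcoord xi) (fun x => conn_mx G x X) (bcoord w) -
       'D_(bcoord xi) (fun x => conn_mx G x X) (bcoord w) *m fcoord w))).
Proof.
move=> Dw.
have dc : is_derive w xi (fun v => conn_mx G (bcoord v) X)
    ('D_(bcoord xi) (fun x => conn_mx G x X) (bcoord w)).
  apply: (is_derive_comp_linear (F := fun x => conn_mx G x X)); first exact: bcoord_linear.
  apply: differentiable_is_derive.
  exact: (smooth_differentiable (smooth_conn_mx oD sG metric_unit X) Dw).
have dt : is_derive w xi (@fcoord R n) (fcoord xi).
  exact: (is_derive_linear (@fcoord_linear R n) (is_derive_id w xi)).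
have key := is_derive_row_mx (is_derive_cst X w xi) (is_derive_linear (@mxvec_linear R n)
  (is_deriveB (is_derive_mulmx dt dc) (is_derive_mulmx dc dt))).
have -> : (fun v => hlift G v X) = (fun v => row_mx X (mxvec
   (((fun y => fcoord y *m conn_mx G (bcoord y) X) -
     (fun y => conn_mx G (bcoord y) X *m fcoord y)) v))).
  by apply/funext => v; rewrite hliftE.
apply: is_derive_eq key _; rewrite /vlift; congr row_mx; congr mxvec.
by rewrite opprD [X in _ + X = _]addrC addrACA.
Qed.

Lemma hpart_linear : linear (@hpart R n).
Proof. by move=> c v w; rewrite /hpart linearP. Qed.

Lemma smooth_vpart xi : smooth_on DD (fun w => vpart G w xi).
Proof.
move=> k; have oDD := bundle_open.
have lV : linear (fun v : 'rV[R]_(n + n * n) => vec_mx (rsubmx (- v)) : 'M[R]_n).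
  by move=> c v w; rewrite opprD -scalerN !linearP.
have key := CkD oDD (Ck_cst k DD (vec_mx (rsubmx xi) : 'M[R]_n))
  (Ck_linear oDD lV (smooth_hlift (hpart xi) k)).
by apply: Ck_eq key => // w _; rewrite /vpart !linearB /= !linearN.
Qed.

Lemma smooth_sasaki : smooth_on DD S.
Proof.
move=> k; have oDD := bundle_open; apply/Ck_mxP => // p q.
have sv xi i j : Ck k DD (fun w => vpart G w xi i j : R^o).
  exact: ((Ck_mxP k _ oDD).1 (smooth_vpart xi k) i j).
have sg i j : Ck k DD (fun w => G (bcoord w) i j : R^o).
  exact: ((Ck_mxP k _ oDD).1 (smooth_metric_bcoord k) i j).
have sgi i j : Ck k DD (fun w => invmx (G (bcoord w)) i j : R^o).
  have uG w : DD w -> G (bcoord w) \in unitmx by move=> Dw; exact: metric_unit.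
  exact: ((Ck_mxP k _ oDD).1 (Ck_invmx oDD uG (smooth_metric_bcoord k)) i j).
have key : Ck k DD (fun w => sasaki_form G f w (delta_mx 0 p) (delta_mx 0 q) : R^o).
  apply: CkD => //.
    by do 4 (apply: Ck_sum => // ? _); do !apply: CkM => //.
  apply: CkM => //.
    exact: (Ck_comp oDD oD (fun w Dw => Dw) (Ck_bcoord k oDD) (sf k)).
  apply: ((Ck_mxP k (fun w => hpart (delta_mx 0 p) *m G (bcoord w) *m
    (hpart (delta_mx 0 q))^T) oDD).1 _ 0 0).
  apply: Ck_mulmx => //; last exact: Ck_cst.
  by apply: Ck_mulmx => //; [exact: Ck_cst|exact: smooth_metric_bcoord].
by apply: Ck_eq key => // w _; rewrite mxE.
Qed.

(** The metric on (1,1)-tensors as a trace, so that it can be handled by matrix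
    algebra. *)
Lemma tensor_formE w B C : tensor_form G w B C =
  \tr (B^T *m G (bcoord w) *m C *m (invmx (G (bcoord w)))^T).
Proof.
rewrite /tensor_form /mxtrace exchange_big; apply: eq_bigr => j _ /=.
rewrite !mxE; under [in RHS]eq_bigr => l _.
  rewrite !mxE mulr_suml; under eq_bigr => c _ do rewrite !mxE mulr_suml mulr_suml.
  over.
rewrite [RHS]exchange_big; under [in RHS]eq_bigr do rewrite exchange_big.
rewrite [RHS]exchange_big /=; apply: eq_bigr => i _; apply: eq_bigr => c _.
by apply: eq_bigr => l _; rewrite [B^T _ _]mxE; ring.
Qed.

Lemma tensor_formC w B C : DD w -> tensor_form G w B C = tensor_form G w C B.
Proof.
move=> Dw; rewrite !tensor_formE -[LHS]mxtrace_tr !trmx_mul !trmxK symG //.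
by rewrite [RHS]mxtrace_mulC trmx_inv symG // !mulmxA.
Qed.

(** For [C := G^-1 B G^T] the form reduces to [tr (B^T B)], a sum of squares. *)
Lemma tensor_form_nondegenerate w B : DD w ->
  (forall C, tensor_form G w B C = 0) -> B = 0.
Proof.
move=> Dw B0; have uG := metric_unit Dw.
(* This choice of [C] cancels both metric factors of the trace. *)
have := B0 (invmx (G (bcoord w)) *m B *m (G (bcoord w))^T).
rewrite tensor_formE !mulmxA (mulmxK uG) -mulmxA -trmx_mul mulVmx // trmx1 mulmx1.
rewrite /mxtrace => trB; apply/matrixP => i j; rewrite [RHS]mxE.
have sq k : (B^T *m B) k k = \sum_l B l k ^+ 2.
  by rewrite mxE; apply: eq_bigr => l _; rewrite mxE expr2.
have pos l k : 0 <= B l k ^+ 2 by exact: sqr_ge0.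
have : \sum_k \sum_l B l k ^+ 2 == 0.
  by rewrite -[X in _ == X]trB; apply/eqP/eq_bigr => k _; rewrite sq.
rewrite psumr_eq0; last by move=> k _; exact: sumr_ge0.
move/allP/(_ j (mem_index_enum _)); rewrite psumr_eq0 //.
by move/allP/(_ i (mem_index_enum _)); rewrite sqrf_eq0 => /eqP.
Qed.

Lemma lift_decomposition w xi :
  xi = hlift G w (hpart xi) + vlift (vpart G w xi).
Proof.
rewrite -[xi in LHS](addrNK (hlift G w (hpart xi))) addrC; congr (_ + _).
rewrite /vlift /vpart vec_mxK -[LHS]hsubmxK; congr row_mx.
by rewrite linearB /= -![lsubmx _]/(hpart _) hpart_hlift subrr.
Qed.

Lemma sasaki_hpart0 w xi : DD w ->
  (forall Y, metric_form (S w) xi (hlift G w Y) = 0) -> hpart xi = 0.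
Proof.
move=> Dw xi0; apply/eqP; apply: contraT => h0.
have := xi0 (hpart xi); rewrite {1}(lift_decomposition w xi) metric_formDl.
rewrite sasaki_vh addr0 sasaki_hh => /eqP.
by rewrite mulf_eq0 !gt_eqF //; [exact: posG|exact: f_gt0].
Qed.

Lemma sasaki_vpart0 w xi : DD w ->
  (forall C, metric_form (S w) xi (vlift C) = 0) -> vpart G w xi = 0.
Proof.
move=> Dw xi0; apply: (tensor_form_nondegenerate Dw) => C.
have := xi0 C; rewrite {1}(lift_decomposition w xi) metric_formDl sasaki_vv.
by rewrite sasaki_mxE /sasaki_form vpart_hlift hpart_vlift /tensor_form
  /metric_form trmx0 mulmx0 mxE mulr0 addr0 big1 ?add0r // => i _;
  do 3 (apply: big1 => ? _); rewrite [in LHS]mxE mulr0 mul0r.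
Qed.

Lemma sasaki_unit w : DD w -> S w \in unitmx.
Proof.
move=> Dw; rewrite -row_free_unit; apply: inj_row_free => xi xi0.
have E eta : metric_form (S w) xi eta = 0 by rewrite /metric_form xi0 mul0mx mxE.
rewrite (lift_decomposition w xi) (sasaki_hpart0 Dw) ?(sasaki_vpart0 Dw) //.
by rewrite linear0 add0r /vlift linear0 row_mx0.
Qed.

Lemma sasaki_symmetric w : DD w -> (S w)^T = S w.
Proof.
move=> Dw; apply/matrixP => i j; rewrite !mxE /sasaki_form tensor_formC //.
by rewrite metric_formC // symG.
Qed.

Lemma near_sasaki_symmetric w : DD w -> \forall v \near w, (S v)^T = S v.
Proof.
move=> Dw; near=> v; apply: sasaki_symmetric; near: v.
by apply: open_nbhs_nbhs; split=> //; exact: bundle_open.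
Unshelve. all: by end_near. Qed.

(** The metric of the fibres is parallel for the connection induced on tensors:
    the derivatives of [G] and of [G^-1] produce the left and right products with
    the connection form which make up the two commutators. *)
Lemma derive_tensor_form w X B C : DD w ->
  'D_(hlift G w X) (fun v => tensor_form G v B C : R^o) w =
  tensor_form G w (conn_mx G (bcoord w) X *m B - B *m conn_mx G (bcoord w) X) C +
  tensor_form G w B (conn_mx G (bcoord w) X *m C - C *m conn_mx G (bcoord w) X).
Proof.
move=> Dw; set xi := hlift G w X; have bxi : bcoord xi = X by exact: row_mxKl.
have uG := metric_unit Dw.
have hG : is_derive w xi (fun v => G (bcoord v)) ('D_X G (bcoord w)).
  apply: (is_derive_comp_linear (F := G)); first exact: bcoord_linear.
  by rewrite bxi; apply: differentiable_is_derive; exact: smooth_differentiable sG Dw.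
have nDD : \forall v \near w, DD v.
  by apply: open_nbhs_nbhs; split=> //; exact: bundle_open.
have hI : is_derive w xi (fun v => invmx (G (bcoord v)))
    (- (invmx (G (bcoord w)) *m 'D_X G (bcoord w) *m invmx (G (bcoord w)))).
  apply: is_derive_invmx hG _.
    by near=> v; apply: metric_unit; near: v.
  apply/diff_derivable.
  have uGv v : DD v -> G (bcoord v) \in unitmx by move=> Dv; exact: metric_unit.
  by have [dI _] := Ck_invmx bundle_open uGv (smooth_metric_bcoord 1); exact: dI.
have lL : linear (fun E : 'M[R]_n => B^T *m E *m C).
  by move=> c E E'; rewrite mulmxDr mulmxDl -scalemxAr -scalemxAl.
have ltr : linear (trmx : 'M[R]_n -> 'M[R]_n) by move=> c E E'; rewrite linearP.
have [_ key] := is_derive_trace (is_derive_mulmx (is_derive_linear lL hG)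
  (is_derive_linear ltr hI)).
transitivity ('D_xi (fun v => \tr (B^T *m G (bcoord v) *m C *m
    (invmx (G (bcoord v)))^T) : R^o) w).
  apply: (congr1 (fun F : _ -> R^o => 'D_xi F w)).
  by apply/funext => v; rewrite tensor_formE.
apply: etrans key _; rewrite (derive_metric oD sG symG metric_unit _ Dw) !tensor_formE.
set c := conn_mx G (bcoord w) X; set g := G (bcoord w) in uG *.
have -> : invmx g *m (c^T *m g + g *m c) *m invmx g = invmx g *m c^T + c *m invmx g.
  by rewrite mulmxDr mulmxDl mulmxA mulmxK // mulKmx.
have trB (E E' : 'M[R]_n) : (E - E')^T = E^T - E'^T by rewrite linearB.
have trD (E E' : 'M[R]_n) : (E + E')^T = E^T + E'^T by rewrite linearD.
have trN (E : 'M[R]_n) : (- E)^T = - E^T by rewrite linearN.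
rewrite trN trD trB !trmx_mul trmxK.
move: (invmx g)^T => gi.
rewrite !(mulmxDl, mulmxDr, mulmxBl, mulmxBr, mulNmx, mulmxN) !mulmxA.
rewrite !(mxtraceD, raddfB, raddfN) /=.
have -> : \tr (c^T *m B^T *m g *m C *m gi) = \tr (B^T *m g *m C *m gi *m c^T).
  by rewrite [RHS]mxtrace_mulC !mulmxA.

by ring.
Unshelve. all: by end_near. Qed.

(** * Covariant derivatives of the lifts and of the product structure *)

Lemma vlift0 : vlift (0 : 'M[R]_n) = 0.
Proof. by rewrite /vlift linear0 row_mx0. Qed.

Lemma tensor_formNr w B C : tensor_form G w B (- C) = - tensor_form G w B C.
Proof. by rewrite !tensor_formE mulmxN mulNmx raddfN. Qed.

(** Isolates the horizontal projection, the only part of [J] which varies from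
    point to point. *)
Lemma product_structureE w xi :
  product_structure G w xi = xi - 2 *: hlift G w (hpart xi).
Proof.
rewrite /product_structure [X in _ = X - _](lift_decomposition w xi).
by rewrite scaler_nat mulr2n opprD addrA [X in _ = X - _ - _]addrC addrK.
Qed.

(** The fibre component of the bracket of the horizontal lifts of two constant
    vectors, see [bracket_hlift]. *)
Definition curv_comm w X Y : 'M[R]_n :=
  fcoord w *m curv_mx G (bcoord w) X Y - curv_mx G (bcoord w) X Y *m fcoord w.

Section AtPoint.
Variables (u : 'rV[R]_(n + n * n)) (Du : DD u).

Local Notation H X := (fun w => hlift G w X).
Local Notation V B := (fun=> vlift B : 'rV[R]_(n + n * n)).
Local Notation m := (metric_form (S u)).
Local Notation c X := (conn_mx G (bcoord u) X).

Lemma differentiable_hlift X : differentiable (H X) u.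
Proof. exact: smooth_differentiable (smooth_hlift X) Du. Qed.

Lemma differentiable_vlift B : differentiable (V B) u.
Proof. exact: differentiable_cst. Qed.

(** The horizontal lift of [X] is [(X, [t, A_X])] in coordinates.  Deriving it along
    the lift of [Y] and antisymmetrizing gives [[t, dA(X, Y)]] and double
    commutators, which the Jacobi identity turns into [[t, [A_X, A_Y]]]. *)
Lemma bracket_hlift X Y :
  'D_(hlift G u X) (H Y) u - 'D_(hlift G u Y) (H X) u = vlift (curv_comm u X Y).
Proof.
have [_ ->] := is_derive_hlift (hlift G u X) Y Du.
have [_ ->] := is_derive_hlift (hlift G u Y) X Du.
have bh Z : bcoord (hlift G u Z) = Z by exact: row_mxKl.
have fh Z : fcoord (hlift G u Z) = fcoord u *m c Z - c Z *m fcoord u.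
  by rewrite hliftE /fcoord row_mxKr mxvecK.
have vB B C : vlift B - vlift C = vlift (B - C).
  by rewrite /vlift linearB opp_row_mx add_row_mx subr0.
rewrite vB !bh !fh /curv_comm /curv_mx; congr vlift.
move: (fcoord u) (c X) (c Y) => t cX cY.
move: ('D_X _ _) ('D_Y _ _) => dX dY.
rewrite !(mulmxDl, mulmxDr, mulmxBl, mulmxBr, mulNmx, mulmxN) !mulmxA.
by mx_abelian.
Qed.

(** Vanishing torsion, with the bracket of a vertical and a horizontal lift. *)
Lemma cov_vlift_hlift B X :
  cov S u (vlift B) (H X) = cov S u (hlift G u X) (V B) + vlift (B *m c X - c X *m B).
Proof.
have := cov_torsion (V B) (H X) (near_sasaki_symmetric Du) => /= E.
apply/eqP; rewrite addrC -subr_eq E.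
have -> : 'D_(hlift G u X) (V B) u = 0 by exact: derive_cst.
have [_ ->] := is_derive_hlift (vlift B) X Du.
have -> : bcoord (vlift B : 'rV[R]_(n + n * n)) = 0 by exact: row_mxKl.
have -> : fcoord (vlift B : 'rV[R]_(n + n * n)) = B by rewrite /fcoord row_mxKr mxvecK.
by rewrite derive0 mulmx0 mul0mx subrr addr0 subr0.
Qed.

Lemma cov_vlift_vlift B C : cov S u (vlift B) (V C) = cov S u (vlift C) (V B).
Proof.
have := cov_torsion (V B) (V C) (near_sasaki_symmetric Du) => /=.
by rewrite !derive_cst subrr => /eqP; rewrite subr_eq0 => /eqP.
Qed.

Lemma cov_sasaki xi (Y Z : 'rV[R]_(n + n * n) -> 'rV[R]_(n + n * n)) :
  differentiable Y u -> differentiable Z u ->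
  'D_xi (fun v => metric_form (S v) (Y v) (Z v) : R^o) u =
  m (cov S u xi Y) (Z u) + m (Y u) (cov S u xi Z).
Proof.
move=> dY dZ; apply: cov_metric => //; last exact: near_sasaki_symmetric.
- exact: smooth_differentiable smooth_sasaki Du.
- exact: sasaki_unit.
Qed.

Lemma sasakiC xi eta : m xi eta = m eta xi.
Proof. by apply: metric_formC; exact: sasaki_symmetric. Qed.

(** Derivative of the constant function [<V B, H X> = 0]. *)
Lemma cov_lifts_orthogonal xi B X :
  m (cov S u xi (V B)) (hlift G u X) + m (vlift B) (cov S u xi (H X)) = 0.
Proof.
rewrite -(cov_sasaki xi (differentiable_vlift B) (differentiable_hlift X)).
have -> : (fun v => metric_form (S v) (vlift B) (hlift G v X) : R^o) = cst 0.
  by apply/funext => v; rewrite sasaki_vh.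
exact: derive_cst.
Qed.

(** With [<V C, H X> = 0], the number [<nabla_(V B) (V C), H X>] becomes
    [- <V C, nabla_(V B) (H X)>], and exchanging [V B] and [H X] costs a bracket.
    The sum with the same identity for [C] and [B] is the derivative of
    [<V B, V C>] along [H X] corrected by the brackets, that is, zero by
    [derive_tensor_form]. *)
Lemma fibre_totally_geodesic B C : hpart (cov S u (vlift B) (V C)) = 0.
Proof.
apply: (sasaki_hpart0 Du) => X.
have E1 := cov_lifts_orthogonal (vlift B) C X.
have E2 := cov_lifts_orthogonal (vlift C) B X.
have E3 := cov_sasaki (hlift G u X) (differentiable_vlift B) (differentiable_vlift C).
have E4 : 'D_(hlift G u X) (fun v => metric_form (S v) (vlift B) (vlift C) : R^o) u =
    tensor_form G u (c X *m B - B *m c X) C + tensor_form G u B (c X *m C - C *m c X).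
  rewrite -(derive_tensor_form _ _ _ Du).
  apply: (congr1 (fun F : _ -> R^o => 'D_(hlift G u X) F u)).
  by apply/funext => v; rewrite sasaki_vv.
rewrite E4 in E3.
rewrite cov_vlift_hlift metric_formDr sasaki_vv -[B *m _ - _]opprB tensor_formNr in E1.
rewrite cov_vlift_hlift metric_formDr sasaki_vv -[C *m _ - _]opprB tensor_formNr in E2.
rewrite cov_vlift_vlift in E2.
rewrite [tensor_form G u C _]tensor_formC // in E1.
rewrite [m (vlift C) _]sasakiC in E1.
move: E1 E2 E3.
move: (m _ _) (m _ _) (m _ _) (tensor_form _ _ _ _) (tensor_form _ _ _ _) => a b d e h.
by move=> E1 E2 E3; lra.
Qed.

Lemma vpart_cov_vlift_hlift B X : vpart G u (cov S u (vlift B) (H X)) = 0.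
Proof.
apply: (sasaki_vpart0 Du) => C; have := cov_lifts_orthogonal (vlift B) C X.
rewrite (lift_decomposition u (cov S u (vlift B) (V C))) fibre_totally_geodesic.
by rewrite linear0 add0r sasaki_vh add0r sasakiC.
Qed.

(** [<H X, H Y>] is a function on the base, so its vertical derivatives
    vanish. *)
Lemma hlift_metric_fibre_constant B X Y :
  m (cov S u (vlift B) (H X)) (hlift G u Y) + m (hlift G u X) (cov S u (vlift B) (H Y)) = 0.
Proof.
rewrite -(cov_sasaki (vlift B) (differentiable_hlift X) (differentiable_hlift Y)).
have -> : (fun v => metric_form (S v) (hlift G v X) (hlift G v Y) : R^o) =
    (fun x => f x * metric_form (G x) X Y : R^o) \o (@bcoord R n).
  by apply/funext => v; rewrite sasaki_hh.
have bv : bcoord (vlift B : 'rV[R]_(n + n * n)) = 0 by exact: row_mxKl.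
have d0 := is_derive0 (fun x => f x * metric_form (G x) X Y : R^o) (bcoord u).
rewrite -bv in d0.
by have [_ ->] := is_derive_comp_linear (@bcoord_linear R n) d0.
Qed.

(** The number [p(X, Y) = <nabla_(H X) (H Y), V B>] equals
    [- <H Y, nabla_(V B) (H X)>], which is antisymmetric by
    [hlift_metric_fibre_constant]; and [p(X, Y) - p(Y, X)] is given by the
    bracket, so [p] is one half of it. *)
Lemma vpart_cov_hlift_hlift X Y :
  vpart G u (cov S u (hlift G u X) (H Y)) = 2^-1 *: curv_comm u X Y.
Proof.
have key : vpart G u (cov S u (hlift G u X) (H Y) - vlift (2^-1 *: curv_comm u X Y)) = 0.
  apply: (sasaki_vpart0 Du) => B.
  pose p U W := m (cov S u (hlift G u U) (H W)) (vlift B).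
  have pE U W : p U W = - m (hlift G u W) (cov S u (vlift B) (H U)).
    have := cov_lifts_orthogonal (hlift G u U) B W.
    rewrite cov_vlift_hlift metric_formDr [m (hlift G u W) (vlift _)]sasakiC sasaki_vh.
    rewrite addr0 /p [m (hlift G u W) _]sasakiC [m _ (vlift B)]sasakiC.
    by move=> E; apply/eqP; rewrite -addr_eq0 addrC E.
  have pN : p X Y + p Y X = 0.
    rewrite !pE -opprD addrC; apply/eqP; rewrite oppr_eq0; apply/eqP.
    have := hlift_metric_fibre_constant B X Y.
    by rewrite [m _ (hlift G u Y)]sasakiC addrC.
  have := cov_torsion (H X) (H Y) (near_sasaki_symmetric Du) => /=.
  rewrite bracket_hlift => /(congr1 (fun xi => m xi (vlift B))).
  have mB xi xi' eta : m (xi - xi') eta = m xi eta - m xi' eta.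
    by rewrite metric_formDl; congr (_ + _); rewrite /metric_form !mulNmx mxE.
  have mZ k xi eta : m (k *: xi) eta = k * m xi eta.
    by rewrite /metric_form -!scalemxAl mxE.
  have -> : vlift (2^-1 *: curv_comm u X Y) = 2^-1 *: vlift (curv_comm u X Y).
    by rewrite /vlift linearZ scale_row_mx scaler0.
  rewrite mB -/(p X Y) -/(p Y X) => E; rewrite mB mZ -E -/(p X Y).
  by move: pN; move: (p X Y) (p Y X) => a b ab0; lra.
have vpartB xi eta : vpart G u (xi - eta) = vpart G u xi - vpart G u eta.
  by rewrite linearB.
by move/eqP: key; rewrite vpartB vpart_vlift subr_eq0 => /eqP.
Qed.

(** [<nabla_(H X) (V B), H Y>] is the opposite of [<V B, nabla_(H X) (H Y)>], where
    the second argument has no vertical part. *)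
Lemma hpart_cov_hlift_vlift X B :
  (forall Y, curv_comm u X Y = 0) -> hpart (cov S u (hlift G u X) (V B)) = 0.
Proof.
move=> flat0; apply: (sasaki_hpart0 Du) => Y.
have := cov_lifts_orthogonal (hlift G u X) B Y.
rewrite (lift_decomposition u (cov S u _ (H Y))) vpart_cov_hlift_hlift flat0.
by rewrite scaler0 vlift0 addr0 sasaki_vh addr0.
Qed.

(** Leibniz rule for the horizontal projection of a field: expand it in the lifts
    of the coordinate vectors, with the components of the field as
    coefficients. *)
Lemma is_derive_hlift_hpart xi (Y : 'rV[R]_(n + n * n) -> 'rV[R]_(n + n * n)) :
  differentiable Y u ->
  is_derive u xi (fun w => hlift G w (hpart (Y w)))
    (hlift G u (hpart ('D_xi Y u)) + 'D_xi (H (hpart (Y u))) u).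
Proof.
move=> dY.
have sumE w X : hlift G w X = \sum_s X 0 s *: hlift G w (delta_mx 0 s).
  by rewrite {1}(row_sum_delta X) linear_sum; apply: eq_bigr => s _; rewrite linearZ.
have hY s : is_derive u xi (fun w => hpart (Y w) 0 s) (hpart ('D_xi Y u) 0 s).
  by have /is_derive_mxP := is_derive_linear hpart_linear (differentiable_is_derive xi dY).
have hH s : is_derive u xi (H (delta_mx 0 s)) ('D_xi (H (delta_mx 0 s)) u).
  exact/differentiable_is_derive/differentiable_hlift.
have -> : (fun w => hlift G w (hpart (Y w))) =
    (fun w => \sum_s hpart (Y w) 0 s *: hlift G w (delta_mx 0 s)).
  by apply/funext => w; exact: sumE.
apply: (is_derive_eq (is_derive_finite_sum (fun s => is_derive_scale_mx (hY s) (hH s)))).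
rewrite big_split /= -sumE; congr (_ + _).
have -> : H (hpart (Y u)) = (fun w => \sum_s hpart (Y u) 0 s *: hlift G w (delta_mx 0 s)).
  by apply/funext => w; exact: sumE.
by have [_ ->] := is_derive_finite_sum (fun s => is_deriveZ (hpart (Y u) 0 s) (hH s)).
Qed.

Lemma hpart_derive_hlift xi X : hpart ('D_xi (H X) u) = 0.
Proof. by have [_ ->] := is_derive_hlift xi X Du; exact: hpart_vlift. Qed.

(** The left-hand side is [(nabla_xi J) Y = - 2 (nabla_xi P) Y].  It is tensorial
    in [Y], so it can be computed on the adapted frame field with the same value
    at [u]: it picks the vertical part of [nabla_xi (H X)] and the horizontal
    part of [nabla_xi (V B)]. *)
Lemma cov_product_structure xi (Y : 'rV[R]_(n + n * n) -> 'rV[R]_(n + n * n)) :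
  differentiable Y u ->
  cov S u xi (fun w => product_structure G w (Y w)) -
    product_structure G u (cov S u xi Y) =
  2 *: (hlift G u (hpart (cov S u xi (V (vpart G u (Y u))))) -
        vlift (vpart G u (cov S u xi (H (hpart (Y u)))))).
Proof.
move=> dY; set X0 := hpart (Y u); set B0 := vpart G u (Y u).
have hP := is_derive_hlift_hpart xi dY.
have dJ : 'D_xi (fun w => product_structure G w (Y w)) u =
    'D_xi Y u - 2 *: (hlift G u (hpart ('D_xi Y u)) + 'D_xi (H X0) u).
  have [_ <-] := is_deriveB (differentiable_is_derive xi dY) (is_deriveZ 2 hP).
  apply: (congr1 (fun F => 'D_xi F u)); apply/funext => w.
  exact: product_structureE.
have decH : vlift (vpart G u (cov S u xi (H X0))) =
    cov S u xi (H X0) - hlift G u (hpart (cov S u xi (H X0))).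
  apply/eqP; rewrite eq_sym subr_eq addrC; apply/eqP; exact: lift_decomposition.
rewrite decH product_structureE /cov dJ product_structureE -/X0.
have Yu : Y u = hlift G u X0 + vlift B0 by exact: lift_decomposition.
have hD a b : hpart (a + b) = hpart a + hpart b :> 'rV[R]_n by rewrite /hpart linearD.
have hlD a b : hlift G u (a + b) = hlift G u a + hlift G u b by rewrite linearD.
have -> : 'D_xi (V B0) u = 0 by exact: derive_cst.
rewrite add0r !hD hpart_derive_hlift add0r !hlD.
set dY0 := 'D_xi Y u; set dH0 := 'D_xi (H X0) u; set cm := (conn_mx S u xi)^T.
have -> : hpart (Y u *m cm) = hpart (hlift G u X0 *m cm) + hpart (vlift B0 *m cm).
  by rewrite Yu mulmxDl hD.
rewrite hlD mulmxBl -scalemxAl.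
move: (hlift G u (hpart dY0)) (hlift G u (hpart _)) (hlift G u (hpart _)) => e1 e2 e3.
by clearbody dY0 dH0; clear; mx_abelian.
Qed.

Lemma product_structure_parallel xi (Y : 'rV[R]_(n + n * n) -> 'rV[R]_(n + n * n)) :
  differentiable Y u -> (forall X Z, curv_comm u X Z = 0) ->
  cov S u xi (fun w => product_structure G w (Y w)) -
    product_structure G u (cov S u xi Y) = 0.
Proof.
move=> dY flat0; rewrite cov_product_structure //.
set X0 := hpart (Y u); set B0 := vpart G u (Y u).
have split_cov (Z : 'rV[R]_(n + n * n) -> 'rV[R]_(n + n * n)) : differentiable Z u ->
    cov S u xi Z = cov S u (hlift G u (hpart xi)) Z + cov S u (vlift (vpart G u xi)) Z.
  move=> dZ; rewrite {1}(lift_decomposition u xi).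
  have := cov_linear S dZ 1 (hlift G u (hpart xi)) (vlift (vpart G u xi)).
  by rewrite !scale1r.
have hD a b : hpart (a + b) = hpart a + hpart b :> 'rV[R]_n by rewrite /hpart linearD.
have vD a b : vpart G u (a + b) = vpart G u a + vpart G u b by rewrite linearD.
rewrite (split_cov _ (differentiable_vlift B0)) (split_cov _ (differentiable_hlift X0)).
rewrite hD vD fibre_totally_geodesic vpart_cov_vlift_hlift vpart_cov_hlift_hlift.
rewrite hpart_cov_hlift_vlift // flat0 scaler0 !addr0 vlift0.
by rewrite linear0 subr0 scaler0.
Qed.

Lemma cov_product_structure_hlift xi X (Y : 'rV[R]_(n + n * n) -> 'rV[R]_(n + n * n)) :
  differentiable Y u -> Y u = hlift G u X ->
  cov S u xi (fun w => product_structure G w (Y w)) -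
    product_structure G u (cov S u xi Y) =
  - (2 *: vlift (vpart G u (cov S u xi (H X)))).
Proof.
move=> dY Yu; rewrite cov_product_structure // Yu hpart_hlift vpart_hlift vlift0.
have -> : cov S u xi (fun=> 0) = 0 by rewrite /cov derive_cst mul0mx addr0.
have -> : hpart 0 = 0 :> 'rV[R]_n by rewrite /hpart linear0.
by rewrite linear0 sub0r scalerN.
Qed.

Lemma curv_commC X Y : curv_comm u Y X = - curv_comm u X Y.
Proof.
have E : curv_mx G (bcoord u) Y X = - curv_mx G (bcoord u) X Y.
  by rewrite /curv_mx opprD !opprB.
by rewrite /curv_comm E mulmxN mulNmx opprB opprK addrC.
Qed.

End AtPoint.
End AdaptedFrame.

(** * Torsion of the almost product connection *)

Section Torsion.
Variables (R : realType) (n : nat) (M : topologicalType) (A : atlas R n M).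
Variables (g : metric_field A) (f : M -> R).
Hypotheses (hM : smooth_manifold A) (hg : riemannian_metric g).
Hypotheses (hf : smooth_function A f) (f_gt0 : forall p : M, 0 < f p).

Local Notation bundle := (bundle11 A).
Local Notation DD a :=
  [set w : 'rV[R]_(n + n * n) | @cdom _ _ _ A a (bcoord w)].
Local Notation S a := (sasaki_mx (g a) (fun x => f (point a x))).

Let oD (a : index A) : open (cdom a) := manifold_cdom_open hM (a := a).
Let sG (a : index A) := metric_smooth hg a.
Let symG (a : index A) : forall x, cdom a x -> (g a x)^T = g a x :=
  fun x => @metric_sym _ _ _ _ _ hg a x.
Let posG (a : index A) : forall x v, cdom a x -> v != 0 ->
  0 < metric_form (g a x) v v := fun x v => @metric_pos _ _ _ _ _ hg a x v.
Let sf (a : index A) := hf a.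
Let fa_gt0 (a : index A) : forall x, cdom a x -> 0 < f (point a x) :=
  fun x _ => f_gt0 (point a x).
Let cB := bundle_charts (manifold_charts hM).

Lemma nablaJE (X Y : vector_field bundle) (a : index A) u :
  nablaJ f g X Y a u =
  cov (S a) u (X a u) (fun w => product_structure (g a) w (Y a w)) -
  product_structure (g a) u (cov (S a) u (X a u) (Y a)).
Proof. by rewrite /nablaJ /pJ !levi_civitaE. Qed.

(** The Levi-Civita connection has no torsion, so that of the product connection
    is the defect of symmetry of [S]. *)
Lemma torsion_product_connection (X Y : vector_field bundle) (a : index A) u :
  DD a u ->
  (product_connection f g X Y a u - product_connection f g Y X a u =
     bracket X Y a u) <->
  product_tensor f g X Y a u = product_tensor f g Y X a u.
Proof.
move=> Du; rewrite /product_connection !levi_civitaE.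
have := cov_torsion (X a) (Y a)
  (near_sasaki_symmetric (fun x => f (point a x)) (oD (a:=a)) (@symG a) Du).
rewrite -/(bracket X Y a u).
set p := cov _ _ _ (Y a); set q := cov _ _ _ (X a).
set s := product_tensor f g X Y a u; set t := product_tensor f g Y X a u => E.
have -> : p - s - (q - t) = bracket X Y a u - (s - t).
  by rewrite -E !opprB addrACA [RHS]addrACA [- s - q]addrC.
split=> [/eqP|->]; last by rewrite subrr subr0.
by rewrite -subr_eq0 addrAC subrr sub0r oppr_eq0 subr_eq0 => /eqP.
Qed.

Lemma bundle_cdom_bcoord (a : index A) u : @cdom _ _ _ bundle a u -> DD a u.
Proof. by rewrite (bundle_cdomE (manifold_charts hM)). Qed.

Lemma product_structure0 (a : index A) u : product_structure (g a) u 0 = 0.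
Proof.
rewrite product_structureE; have -> : hpart 0 = 0 :> 'rV[R]_n by rewrite /hpart linear0.
by rewrite linear0 scaler0 subr0.
Qed.

Lemma flat_torsion_free : flat g -> torsion_free (product_connection f g).
Proof.
move=> flatg W X Y _ [sX _] [sY _] a0 u; pose a : index A := a0; rewrite -[a0]/a => Wu.
have Du : DD a u by apply: bundle_cdom_bcoord; case: Wu.
have dX : differentiable (X a) u := smooth_differentiable (sX a) Wu.
have dY : differentiable (Y a) u := smooth_differentiable (sY a) Wu.
apply/(torsion_product_connection X Y Du).
have curv0 U Z : curv_comm (g a) u U Z = 0.
  have E : curv_mx (g a) (bcoord u) U Z = 0.
    apply/matrixP => l k.
    rewrite (curv_mxE (oD (a:=a)) (sG a) (metric_unit (@posG a)) _ _ _ _ Du).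
    rewrite [RHS]mxE; apply: big1 => i _; apply: big1 => j _.
    by rewrite flatg // mulr0.
  by rewrite /curv_comm E mulmx0 mul0mx subrr.
have nJ0 (Z1 Z2 : vector_field bundle) : differentiable (Z2 a) u ->
    nablaJ f g Z1 Z2 a u = 0.
  move=> dZ; rewrite nablaJE.
  exact: (product_structure_parallel (oD (a:=a)) (sG a) (@sf a) (@symG a)
    (@posG a) (@fa_gt0 a) Du _ dZ curv0).
have S0 (Z1 Z2 : vector_field bundle) : differentiable (Z1 a) u ->
    differentiable (Z2 a) u -> product_tensor f g Z1 Z2 a u = 0.
  move=> d1 d2; rewrite /product_tensor /pJ !nJ0 // product_structure0.
  by rewrite addr0 subr0 scaler0.
by rewrite !S0.
Qed.

(** On fields with horizontal values at [u], [S(X, Y)] is half of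
    [vlift (curv_comm X Y)]: symmetric by vanishing of the torsion and
    antisymmetric like the curvature, it is zero. *)
Lemma torsion_free_curv_comm (a : index A) u X Y :
  torsion_free (product_connection f g) -> DD a u -> curv_comm (g a) u X Y = 0.
Proof.
move=> tf Du.
have au : @cdom _ _ _ bundle a u by rewrite (bundle_cdomE (manifold_charts hM)).
(* Only the value at [u] of a field matters, so coordinate fields suffice. *)
pose field Z : vector_field bundle := constant_field (A := bundle) a (hlift (g a) u Z).
have fieldE Z : field Z a u = hlift (g a) u Z by exact: (constant_fieldE cB).
have fieldW Z : vector_field_on (@dom _ _ _ bundle a) (field Z).
  exact: (constant_field_on cB).
clearbody field.
have Wu : @chart_part _ _ _ bundle (@dom _ _ _ bundle a) a u.
  by split=> //; exact: (cdom_point cB au).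
have dfield Z : differentiable (field Z a) u.
  by have [sZ _] := fieldW Z; exact: smooth_differentiable (sZ a) Wu.
have oW : atlas_open bundle (@dom _ _ _ bundle a) by exact: (dom_atlas_open cB).
have := tf _ _ _ oW (fieldW X) (fieldW Y) a u Wu.
move/(torsion_product_connection (field X) (field Y) Du).
have nJ (Z : vector_field bundle) U : nablaJ f g Z (field U) a u =
    - (2 *: vlift (vpart (g a) u (cov (S a) u (Z a u) (fun w => hlift (g a) w U)))).
  rewrite nablaJE.
  exact: (cov_product_structure_hlift _ (oD (a:=a)) (sG a) (@posG a) Du _
    (dfield U) (fieldE U)).
have vc U Z : vpart (g a) u (cov (S a) u (hlift (g a) u U) (fun w => hlift (g a) w Z)) =
    2^-1 *: curv_comm (g a) u U Z.
  exact: (vpart_cov_hlift_hlift (oD (a:=a)) (sG a) (@sf a) (@symG a)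
    (@posG a) (@fa_gt0 a) Du).
have vZ k B : vlift (k *: B) = k *: vlift B :> 'rV[R]_(n + n * n).
  by rewrite /vlift linearZ scale_row_mx scaler0.
have nJH U Z : nablaJ f g (field U) (field Z) a u = - vlift (curv_comm (g a) u U Z).
  by rewrite nJ fieldE vc vZ scalerA mulfV ?scale1r ?pnatr_eq0.
have nJN U Z : nablaJ f g (pJ g (field U)) (field Z) a u = vlift (curv_comm (g a) u U Z).
  rewrite nJ /pJ fieldE product_structure_hlift.
  have covN : cov (S a) u (- hlift (g a) u U) (fun w => hlift (g a) w Z) =
      - cov (S a) u (hlift (g a) u U) (fun w => hlift (g a) w Z).
    have dH : differentiable (fun w => hlift (g a) w Z) u.
      exact: (differentiable_hlift (oD (a:=a)) (sG a) (@posG a) Du).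
    have := cov_linear (S a) dH (-1) (hlift (g a) u U) 0.
    have := cov_linear (S a) dH (-1) 0 0.
    rewrite !scaleN1r !addr0 !oppr0.
    by move=> E0 ->; rewrite [cov (S a) u 0 _]E0 addNr addr0.
  have vN B : vlift (- B) = - vlift B :> 'rV[R]_(n + n * n).
    by rewrite /vlift linearN opp_row_mx oppr0.
  rewrite covN linearN /= vc vN vZ scalerN opprK scalerA.
  by rewrite mulfV ?scale1r ?pnatr_eq0.
have ST U Z : product_tensor f g (field U) (field Z) a u =
    2^-1 *: vlift (curv_comm (g a) u U Z).
  transitivity (2^-1 *: (nablaJ f g (pJ g (field Z)) (field U) a u +
      product_structure (g a) u (nablaJ f g (field Z) (field U) a u) -
      product_structure (g a) u (nablaJ f g (field U) (field Z) a u))) => //.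
  rewrite nJN [in X in _ + X - _]nJH [in X in _ - X]nJH.
  have pN xi : product_structure (g a) u (- xi) = - product_structure (g a) u xi.
    by rewrite !product_structureE /hpart !linearN /= opprD.
  move: (curv_comm _ _ Z U) (curv_comm _ _ U Z) => B C.
  rewrite (pN (vlift B)) (pN (vlift C)) !product_structure_vlift.
  by rewrite opprK subrr add0r.
rewrite !ST (curv_commC (g a) u X Y) => /(scalerI (invr_neq0 _)) E.
have {E} : curv_comm (g a) u X Y = - curv_comm (g a) u X Y.
  have := congr1 (vpart (g a) u) (E _); rewrite !vpart_vlift; apply.
  by rewrite pnatr_eq0.
move/eqP; rewrite -addr_eq0 -mulr2n -scaler_nat scaler_eq0 pnatr_eq0 /=.
by move/eqP.
Qed.

(** The curvature commutes with the fibre coordinate [t], which is arbitrary; it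
    is then a scalar matrix [b] with [2 b G = 0]. *)
Lemma torsion_free_flat : torsion_free (product_connection f g) -> flat g.
Proof.
move=> tf a x l k i j ax.
have curv0 X Y : curv_mx (g a) x X Y = 0.
  have scal : is_scalar_mx (curv_mx (g a) x X Y).
    apply: commuting_scalar_mx => t.
    (* The point of the bundle above [x] with fibre coordinate [t]. *)
    pose u : 'rV[R]_(n + n * n) := row_mx x (mxvec t).
    have bu : bcoord u = x by exact: row_mxKl.
    have fu : fcoord u = t by rewrite /fcoord row_mxKr mxvecK.
    have Du : DD a u by rewrite /= bu.
    have := torsion_free_curv_comm X Y tf Du.
    by rewrite /curv_comm bu fu => /eqP; rewrite subr_eq0 => /eqP.
  have skew := curv_mx_skew (oD (a:=a)) (sG a) (@symG a) (metric_unit (@posG a)) X Y ax.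
  move: scal skew => /is_scalar_mxP[b ->].
  rewrite tr_scalar_mx mul_scalar_mx mul_mx_scalar -mulr2n -scaler_nat scalerA => /eqP.
  rewrite scaler_eq0 mulf_eq0 pnatr_eq0 /= => /orP[/eqP -> |/eqP g0].
    by rewrite raddf0.
  (* If [G = 0] at [x], positivity leaves no index. *)
  apply/matrixP => p q; have := posG (v := delta_mx 0 p) ax.
  rewrite g0 /metric_form mulmx0 mul0mx mxE ltxx => H.
  have : (delta_mx 0 p : 'rV[R]_n) != 0.
    by apply/eqP => /matrixP/(_ 0 p); rewrite !mxE !eqxx => /eqP; rewrite oner_eq0.
  by move/H.
have /matrixP/(_ l k) := curv0 (delta_mx 0 i) (delta_mx 0 j).
rewrite (curv_mxE (oD (a:=a)) (sG a) (metric_unit (@posG a)) _ _ _ _ ax) [RHS]mxE.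
rewrite (bigD1 i) //= [X in _ + X]big1 => [|i' i'i]; last first.
  by apply: big1 => j' _; rewrite !mxE (negbTE i'i) mul0r mul0r.
rewrite (bigD1 j) //= [X in _ + X + _]big1 => [|j' j'j]; last first.
  by rewrite !mxE (negbTE j'j) mulr0 mul0r.
by rewrite !mxE !eqxx !mul1r !addr0.
Qed.

End Torsion.

Theorem theorem5 (R : realType) (n : nat) (M : topologicalType)
    (A : atlas R n M) (g : metric_field A) (f : M -> R)
    (hM : smooth_manifold A) (hg : riemannian_metric g)
    (hf : smooth_function A f) (f_gt0 : forall p : M, 0 < f p) :
  torsion_free (product_connection f g) <-> flat g.
Proof.
split; first exact: torsion_free_flat.
exact: flat_torsion_free.
Qed.
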